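(* The $\mathbb{Q}(r,s)$-algebra $U_{r,s}(\mathfrak{sl}_\infty)$ is a Hopf algebra with comultiplication $\Delta$, counit $\epsilon$ and antipode $S$ determined by, for all $i\in\mathbb{N}$, $$\Delta(w_i^{\pm1})=w_i^{\pm1}\otimes w_i^{\pm1},\qquad \Delta(w_i'^{\pm1})=w_i'^{\pm1}\otimes w_i'^{\pm1},$$ $$\Delta(e_i)=e_i\otimes 1+w_i\otimes e_i,\qquad \Delta(f_i)=1\otimes f_i+f_i\otimes w_i',$$ $$\epsilon(w_i^{\pm1})=\epsilon(w_i'^{\pm1})=1,\qquad \epsilon(e_i)=\epsilon(f_i)=0,$$ $$S(w_i^{\pm1})=w_i^{\mp1},\qquad S(w_i'^{\pm1})=w_i'^{\mp1},\qquad S(e_i)=-w_i^{-1}e_i,\qquad S(f_i)=-f_iw_i'^{-1}.$$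
   Context: $\mathbb{N}=\{1,2,3,\dots\}$, and $\mathbb{Q}(r,s)$ is the field of rational functions in two independent variables $r,s$. On the free abelian group with basis $\alpha_i$ ($i\in\mathbb{N}$) let $\langle-,-\rangle$ be the bilinear form with $\langle i,j\rangle:=\langle\alpha_i,\alpha_j\rangle$ equal to $1$ if $i=j$, $-1$ if $j=i+1$, and $0$ otherwise. $U_{r,s}(\mathfrak{sl}_\infty)$ is the unital associative $\mathbb{Q}(r,s)$-algebra generated by $e_i,f_i,w_i^{\pm1},w_i'^{\pm1}$ ($i\in\mathbb{N}$) subject to the relations: - all $w_i^{\pm1},w_j'^{\pm1}$ commute with each other, $w_i^{\pm1}w_i^{\mp1}=1=w_i'^{\pm1}w_i'^{\mp1}$; - $w_ie_j=r^{\langle j,i\rangle}s^{-\langle i,j\rangle}e_jw_i$, $\;w_i'e_j=r^{-\langle i,j\rangle}s^{\langle j,i\rangle}e_jw_i'$; - $w_if_j=r^{-\langle j,i\rangle}s^{\langle i,j\rangle}f_jw_i$, $\;w_i'f_j=r^{\langle i,j\rangle}s^{-\langle j,i\rangle}f_jw_i'$; - $e_if_j-f_je_i=\delta_{i,j}\dfrac{w_i-w_i'}{r-s}$; - $e_ie_j-e_je_i=f_if_j-f_jf_i=0$ for $|i-j|>1$; - $e_i^2e_{i+1}-(r+s)e_ie_{i+1}e_i+rs\,e_{i+1}e_i^2=0$, $\;e_ie_{i+1}^2-(r+s)e_{i+1}e_ie_{i+1}+rs\,e_{i+1}^2e_i=0$; - $f_i^2f_{i+1}-(r^{-1}+s^{-1})f_if_{i+1}f_i+(rs)^{-1}f_{i+1}f_i^2=0$,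 $\;f_if_{i+1}^2-(r^{-1}+s^{-1})f_{i+1}f_if_{i+1}+(rs)^{-1}f_{i+1}^2f_i=0$. *)

(* Defs.v *)
From HB Require Import structures.
From mathcomp Require Import all_boot all_order all_algebra.
From mathcomp Require Import ring_quotient sesquilinear fraction.
From mathcomp Require Import boolp.
From mathcomp Require Import finmap monalg.

Set Implicit Arguments.
Unset Strict Implicit.
Unset Printing Implicit Defensive.

Import GRing.Theory.
Local Open Scope ring_scope.
Local Open Scope quotient_scope.

(* Quotient of a module by the submodule spanned by the differences x - y of  *)
(* related elements.                                                          *)
Section ModuleQuotient.
Variables (K : fieldType) (V : lmodType K) (R : V -> V -> Prop).

Inductive span_rel : V -> Prop :=
| SpanRel0 : span_rel 0
| SpanRelD c x y v : R x y -> span_rel v -> span_rel (c *: (x - y) + v).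

Lemma span_relD u v : span_rel u -> span_rel v -> span_rel (u + v).
Proof.
move=> hu hv; elim: hu => [|c x y w hxy _ ih]; first by rewrite add0r.
by rewrite -addrA; exact: SpanRelD.
Qed.

Lemma span_relZ a v : span_rel v -> span_rel (a *: v).
Proof.
elim=> [|c x y w hxy _ ih]; first by rewrite scaler0; exact: SpanRel0.
by rewrite scalerDr scalerA; exact: SpanRelD.
Qed.

Lemma span_rel_gen x y : R x y -> span_rel (x - y).
Proof.
move=> h; rewrite -[_ - _]addr0 -[x - y]scale1r.
exact: SpanRelD h SpanRel0.
Qed.

Definition span_pred : {pred V} := fun v => `[< span_rel v >].

Lemma span_predP v : reflect (span_rel v) (v \in span_pred).
Proof. exact: asboolP. Qed.

Lemma span_pred_zmod : zmod_closed span_pred.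
Proof.
split=> [|u v /span_predP hu /span_predP hv]; apply/span_predP.
  exact: SpanRel0.
by apply: span_relD hu _; rewrite -scaleN1r; exact: span_relZ.
Qed.

HB.instance Definition _ := GRing.isZmodClosed.Build V span_pred span_pred_zmod.

Definition modquot := Quotient.quot span_pred.

HB.instance Definition _ := GRing.Zmodule.on modquot.

(* The opaque key keeps unification from unfolding the sealed operations.     *)
Fact modquot_key : unit. Proof. by []. Qed.

Definition mqpi : V -> modquot :=
  locked_with modquot_key (fun v => \pi_(Quotient.quot span_pred) v).
Definition mqrepr : modquot -> V :=
  locked_with modquot_key (fun q => repr (q : Quotient.quot span_pred)).

Lemma mqpiE v : mqpi v = \pi_(Quotient.quot span_pred) v.
Proof. by rewrite /mqpi; case: modquot_key. Qed.

Lemma mqreprK : cancel mqrepr mqpi.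
Proof. by move=> q; rewrite mqpiE /mqrepr; case: modquot_key; exact: reprK. Qed.

Lemma mqpi_eq u v : mqpi u = mqpi v <-> span_rel (u - v).
Proof.
rewrite !mqpiE; split=> [h|h].
  by apply/span_predP; rewrite Quotient.idealrBE; apply/eqP.
by apply/eqP; rewrite -Quotient.idealrBE; apply/span_predP.
Qed.

Lemma mqpiD u v : mqpi (u + v) = mqpi u + mqpi v.
Proof. by rewrite !mqpiE; exact: pi_addr. Qed.

Lemma mqpi0 : mqpi 0 = 0.
Proof. by rewrite mqpiE; exact: pi_zeror. Qed.

Definition mqscale (a : K) (q : modquot) : modquot := mqpi (a *: mqrepr q).

Lemma mqpiZ_subproof a v : mqpi (a *: v) = mqscale a (mqpi v).
Proof.
apply/mqpi_eq; rewrite -scalerBr; apply: span_relZ.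
by apply/mqpi_eq; rewrite mqreprK.
Qed.

Lemma mqscaleA a b q : mqscale a (mqscale b q) = mqscale (a * b) q.
Proof. by rewrite -[q]mqreprK -!mqpiZ_subproof scalerA. Qed.

Lemma mqscale1 : left_id 1 mqscale.
Proof. by move=> q; rewrite -[q]mqreprK -mqpiZ_subproof scale1r. Qed.

Lemma mqscaleDr : right_distributive mqscale +%R.
Proof.
move=> a p q; rewrite -[p]mqreprK -[q]mqreprK.
by rewrite -mqpiD -!mqpiZ_subproof scalerDr mqpiD.
Qed.

Lemma mqscaleDl q : {morph mqscale^~ q : a b / a + b}.
Proof.
by move=> a b; rewrite -[q]mqreprK -!mqpiZ_subproof scalerDl mqpiD.
Qed.

HB.instance Definition _ := GRing.Zmodule_isLmodule.Build K modquot
  mqscaleA mqscale1 mqscaleDr mqscaleDl.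

Lemma mqpi_is_linear : linear mqpi.
Proof. by move=> a u v; rewrite mqpiD mqpiZ_subproof. Qed.

HB.instance Definition _ := GRing.isLinear.Build K V modquot _ mqpi
  mqpi_is_linear.

Lemma mqpi_rel x y : R x y -> mqpi x = mqpi y.
Proof. by move=> h; apply/mqpi_eq; exact: span_rel_gen. Qed.

Lemma span_rel_ker (W : lmodType K) (f : {linear V -> W}) :
  (forall x y, R x y -> f x = f y) -> forall v, span_rel v -> f v = 0.
Proof.
move=> fR v; elim=> [|c x y w hxy _ ih]; first by rewrite linear0.
by rewrite linearD linearZ linearB /= (fR _ _ hxy) subrr scaler0 add0r.
Qed.

Lemma span_rel_eq (W : lmodType K) (f : {linear V -> W}) :
  (forall x y, R x y -> f x = f y) ->
  forall v, f (mqrepr (mqpi v)) = f v.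
Proof.
move=> fR v; apply/eqP; rewrite -subr_eq0 -linearB; apply/eqP.
by apply: span_rel_ker => //; apply/mqpi_eq; rewrite mqreprK.
Qed.

End ModuleQuotient.

(* Quotient of an algebra by the two-sided ideal generated by the differences *)
(* x - y of related elements: this ideal is spanned by the a * (x - y) * b.   *)
Section AlgebraQuotient.
Variables (K : fieldType) (A : algType K) (R : A -> A -> Prop).

Variant ideal_rel : A -> A -> Prop :=
| IdealRel a x y b of R x y : ideal_rel (a * x * b) (a * y * b).

Definition algquot := modquot ideal_rel.

HB.instance Definition _ := GRing.Lmodule.on algquot.

Definition aqpi (x : A) : algquot := mqpi ideal_rel x.
HB.instance Definition _ := GRing.isLinear.Build K A algquot _ aqpi
  (@mqpi_is_linear _ _ ideal_rel).

Definition aqmul : algquot -> algquot -> algquot :=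
  locked_with modquot_key (fun p q => aqpi (mqrepr p * mqrepr q)).

Lemma span_idealMl a x : span_rel ideal_rel x -> span_rel ideal_rel (a * x).
Proof.
elim=> [|c _ _ w [b x' y' d h] _ ih]; first by rewrite mulr0; exact: SpanRel0.
rewrite mulrDr -scalerAr mulrBr !mulrA; apply: SpanRelD ih.
exact: (IdealRel (a * b) d h).
Qed.

Lemma span_idealMr a x : span_rel ideal_rel x -> span_rel ideal_rel (x * a).
Proof.
elim=> [|c _ _ w [b x' y' d h] _ ih]; first by rewrite mul0r; exact: SpanRel0.
rewrite mulrDl -scalerAl mulrBl -!(mulrA _ d a); apply: SpanRelD ih.
exact: IdealRel.
Qed.

Lemma aqpiM x y : aqpi (x * y) = aqmul (aqpi x) (aqpi y).
Proof.
rewrite /aqmul; case: modquot_key => /=.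
apply/mqpi_eq; set x' := mqrepr _; set y' := mqrepr (aqpi y).
have -> : x * y - x' * y' = (x - x') * y + x' * (y - y').
  by rewrite mulrBl mulrBr addrA subrK.
by apply: span_relD; [apply: span_idealMr | apply: span_idealMl];
  apply/mqpi_eq; rewrite mqreprK.
Qed.

Lemma aqpi_surj q : exists x, q = aqpi x.
Proof. by exists (mqrepr q); rewrite /aqpi mqreprK. Qed.

Lemma aqmulA : associative aqmul.
Proof.
move=> p q t; case: (aqpi_surj p) (aqpi_surj q) (aqpi_surj t).
by move=> x -> [y ->] [z ->]; rewrite -!aqpiM mulrA.
Qed.

Lemma aqmul1l : left_id (aqpi 1) aqmul.
Proof. by move=> p; case: (aqpi_surj p) => x ->; rewrite -aqpiM mul1r. Qed.

Lemma aqmul1r : right_id (aqpi 1) aqmul.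
Proof. by move=> p; case: (aqpi_surj p) => x ->; rewrite -aqpiM mulr1. Qed.

Lemma aqmulDl : left_distributive aqmul +%R.
Proof.
move=> p q t; case: (aqpi_surj p) (aqpi_surj q) (aqpi_surj t).
by move=> x -> [y ->] [z ->]; rewrite -linearD -!aqpiM mulrDl linearD.
Qed.

Lemma aqmulDr : right_distributive aqmul +%R.
Proof.
move=> p q t; case: (aqpi_surj p) (aqpi_surj q) (aqpi_surj t).
by move=> x -> [y ->] [z ->]; rewrite -linearD -!aqpiM mulrDr linearD.
Qed.

HB.instance Definition _ := GRing.Zmodule_isPzRing.Build algquot
  aqmulA aqmul1l aqmul1r aqmulDl aqmulDr.

Lemma aqpi_is_monoid_morphism : monoid_morphism aqpi.
Proof. by split=> // x y; rewrite aqpiM. Qed.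

HB.instance Definition _ := GRing.isMonoidMorphism.Build A algquot aqpi
  aqpi_is_monoid_morphism.

Lemma aqscaleAl (c : K) (p q : algquot) : c *: (p * q) = (c *: p) * q.
Proof.
case: (aqpi_surj p) (aqpi_surj q) => x -> [y ->].
by rewrite -[aqpi x * _]rmorphM -linearZ scalerAl rmorphM /= linearZ.
Qed.

Lemma aqscaleAr (c : K) (p q : algquot) : c *: (p * q) = p * (c *: q).
Proof.
case: (aqpi_surj p) (aqpi_surj q) => x -> [y ->].
by rewrite -[aqpi x * _]rmorphM -linearZ scalerAr rmorphM /= linearZ.
Qed.

Lemma aqpi_rel x y : R x y -> aqpi x = aqpi y.
Proof.
by move=> h; apply: mqpi_rel; rewrite -[x]mul1r -[y]mul1r -[1 * x]mulr1
  -[1 * y]mulr1; exact: IdealRel.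
Qed.

End AlgebraQuotient.

Section MalgLift.
Variables (K : fieldType) (T : choiceType) (W : lmodType K) (h : T -> W).

Definition malg_lift (g : {malg K[T]}) : W := \sum_(k <- msupp g) g@_k *: h k.

Lemma malg_liftEw (d : {fset T}) g : (msupp g `<=` d)%fset ->
  malg_lift g = \sum_(k <- d) g@_k *: h k.
Proof.
move=> le; rewrite [LHS](big_fset_incl _ le) => //= x xd /mcoeff_outdom ->.
by rewrite scale0r.
Qed.

Lemma malg_lift_is_linear : linear malg_lift.
Proof.
move=> c g1 g2.
pose E := (msupp g1 `|` msupp g2 `|` msupp (c *: g1 + g2))%fset.
have E1 : (msupp g1 `<=` E)%fset by rewrite /E -fsetUA fsubsetUl.
have E2 : (msupp g2 `<=` E)%fset by rewrite /E fsetUAC fsubsetUr.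
rewrite (malg_liftEw (fsubsetUr _ _ : (_ `<=` E)%fset)).
rewrite (malg_liftEw E1) (malg_liftEw E2).
rewrite scaler_sumr -big_split; apply/eq_bigr => k _ /=.
by rewrite mcoeffD mcoeffZ scalerDl scalerA.
Qed.

HB.instance Definition _ := GRing.isLinear.Build K {malg K[T]} W _ malg_lift
  malg_lift_is_linear.

Lemma malg_liftU k : malg_lift << k >> = h k.
Proof.
by rewrite (malg_liftEw msuppU_le) big_seq_fset1 mcoeffUU scale1r.
Qed.

End MalgLift.

Lemma malg_linear_eq (K : fieldType) (T : choiceType) (W : lmodType K)
  (f g : {linear {malg K[T]} -> W}) :
  (forall k, f << k >> = g << k >>) -> f =1 g.
Proof.
move=> fg x; rewrite [x]monalgE !linear_sum; apply: eq_bigr => k _.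
have -> : << x@_k *g k >> = x@_k *: << k >> :> {malg K[T]}.
  by apply/malgP => l; rewrite mcoeffZ !mcoeffU mulrnAr mulr1.
by rewrite !linearZ /= fg.
Qed.

(* Tensor product over K: the free module on A * B modulo bilinearity.        *)
Section Tensor.
Variables (K : fieldType) (A B : lmodType K).

Variant tens_rel : {malg K[(A * B)%type]} -> {malg K[(A * B)%type]} -> Prop :=
| TensDl a1 a2 b :
    tens_rel << (a1 + a2, b) >> (<< (a1, b) >> + << (a2, b) >>)
| TensDr a b1 b2 :
    tens_rel << (a, b1 + b2) >> (<< (a, b1) >> + << (a, b2) >>)
| TensZl c a b : tens_rel << (c *: a, b) >> (c *: << (a, b) >>)
| TensZr c a b : tens_rel << (a, c *: b) >> (c *: << (a, b) >>).

Definition tens := modquot tens_rel.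

HB.instance Definition _ := GRing.Lmodule.on tens.

Definition tpure (a : A) (b : B) : tens := mqpi tens_rel << (a, b) >>.

(* The linear map induced by f; only meaningful when f is bilinear, see       *)
(* tens_liftE.                                                                *)
Definition tens_lift (W : lmodType K) : (A -> B -> W) -> tens -> W :=
  locked_with modquot_key (fun f t => malg_lift (fun p => f p.1 p.2) (mqrepr t)).

Lemma tens_lift_def (W : lmodType K) (f : A -> B -> W) t :
  tens_lift f t = malg_lift (fun p => f p.1 p.2) (mqrepr t).
Proof. by rewrite /tens_lift; case: modquot_key. Qed.

Lemma tpure_is_bilinear : bilinear_for *:%R *:%R tpure.
Proof.
split=> [b|a] c x y /=; rewrite /tpure.
  by rewrite (mqpi_rel (TensDl _ _ _)) mqpiD (mqpi_rel (TensZl _ _ _)) linearZ.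
by rewrite (mqpi_rel (TensDr _ _ _)) mqpiD (mqpi_rel (TensZr _ _ _)) linearZ.
Qed.

HB.instance Definition _ := bilinear_isBilinear.Build K A B tens _ _ tpure
  tpure_is_bilinear.

Lemma eq_tens_lift (W : lmodType K) (f g : A -> B -> W) :
  f =2 g -> tens_lift f =1 tens_lift g.
Proof. by move=> fg t; rewrite !tens_lift_def; apply: eq_bigr => k _; rewrite fg. Qed.

Lemma tens_lift_linf (W : lmodType K) c (f g : A -> B -> W) t :
  tens_lift (fun a b => c *: f a b + g a b) t
    = c *: tens_lift f t + tens_lift g t.
Proof.
rewrite !tens_lift_def /malg_lift scaler_sumr -big_split; apply: eq_bigr => k _ /=.
by rewrite scalerDr !scalerA mulrC.
Qed.

Section Lift.
Variables (W : lmodType K) (f : A -> B -> W).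
Hypothesis f_bilin : bilinear_for *:%R *:%R f.

Let F := malg_lift (fun p : A * B => f p.1 p.2).

Let F_rel x y : tens_rel x y -> F x = F y.
Proof.
case=> [a1 a2 b|a b1 b2|c a b|c a b]; rewrite /F ?(linearD, linearZ) /=;
  rewrite !malg_liftU /=.
- by have := f_bilin.1 b 1 a1 a2; rewrite /= !scale1r.
- by have := f_bilin.2 a 1 b1 b2; rewrite /= !scale1r.
- have f0 : f 0 b = 0.
    by have := f_bilin.1 b (-1) 0 0; rewrite /= scaler0 addr0 scaleN1r addNr.
  by have := f_bilin.1 b c a 0; rewrite /= !addr0 f0 addr0.
- have f0 : f a 0 = 0.
    by have := f_bilin.2 a (-1) 0 0; rewrite /= scaler0 addr0 scaleN1r addNr.
  by have := f_bilin.2 a c b 0; rewrite /= !addr0 f0 addr0.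
Qed.

Lemma tens_lift_pi x : tens_lift f (mqpi tens_rel x) = F x.
Proof. by rewrite tens_lift_def; exact: (span_rel_eq F_rel). Qed.

Lemma tens_liftE a b : tens_lift f (tpure a b) = f a b.
Proof. by rewrite tens_lift_pi /F malg_liftU. Qed.

Lemma tens_lift_is_linear : linear (tens_lift f).
Proof.
move=> c t u; rewrite -[t]mqreprK -[u]mqreprK -linearP !tens_lift_pi.
exact: linearP.
Qed.

End Lift.

Lemma tens_ind (P : tens -> Prop) :
  (forall t u, P t -> P u -> P (t + u)) ->
  (forall c t, P t -> P (c *: t)) ->
  (forall a b, P (tpure a b)) -> forall t, P t.
Proof.
move=> PD PZ Pp t; rewrite -[t]mqreprK [mqrepr t]monalgE linear_sum /=.
have P0 : P 0 by rewrite -[0](scale0r (tpure 0 0)); exact: PZ.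
elim/big_ind: _ => // k _.
have -> : << (mqrepr t)@_k *g k >> =
    (mqrepr t)@_k *: << k >> :> {malg K[(A * B)%type]}.
  by apply/malgP => l; rewrite mcoeffZ !mcoeffU mulrnAr mulr1.
by rewrite linearZ; apply: PZ; case: k.
Qed.

End Tensor.

Notation "A ⊗ B" := (tens A%type B%type) (at level 40, left associativity) : type_scope.
Notation "a ⊗ b" := (tpure a b) (at level 40, left associativity) : ring_scope.

(* A ⊗ B is an algebra, with (a ⊗ b) (a' ⊗ b') = (a a') ⊗ (b b').             *)
Section TensorAlgebra.
Variables (K : fieldType) (A B : algType K).

Definition tmul : A ⊗ B -> A ⊗ B -> A ⊗ B :=
  locked_with modquot_key (fun t u =>
    tens_lift (fun a b => tens_lift (fun a' b' => (a * a') ⊗ (b * b')) u) t).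

Let tmulp (u : A ⊗ B) a b : A ⊗ B :=
  tens_lift (fun a' b' => (a * a') ⊗ (b * b')) u.

Let tmulp_bilin_arg a b :
  bilinear_for *:%R *:%R (fun a' b' => (a * a') ⊗ (b * b') : A ⊗ B).
Proof.
by split=> [b'|a'] c x y /=; rewrite mulrDr -scalerAr ?linearPl ?linearPr.
Qed.

Let tmulpE a b a' b' : tmulp (a' ⊗ b') a b = (a * a') ⊗ (b * b').
Proof. exact: tens_liftE (tmulp_bilin_arg a b) a' b'. Qed.

Let tmulpP a b c u v : tmulp (c *: u + v) a b = c *: tmulp u a b + tmulp v a b.
Proof. exact: tens_lift_is_linear (tmulp_bilin_arg a b) c u v. Qed.

Let tmulp_bilin u : bilinear_for *:%R *:%R (tmulp u).
Proof.
split=> [b|a] c x y /=; rewrite -[RHS]tens_lift_linf; apply: eq_tens_lift => a' b'.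
  by rewrite mulrDl -scalerAl linearPl.
by rewrite mulrDl -scalerAl linearPr.
Qed.

Let tmul_def t u : tmul t u = tens_lift (tmulp u) t.
Proof. by rewrite /tmul; case: modquot_key. Qed.

Lemma tmulE a b a' b' : tmul (a ⊗ b) (a' ⊗ b') = (a * a') ⊗ (b * b').
Proof. by rewrite tmul_def -tmulpE; exact: tens_liftE (tmulp_bilin _) a b. Qed.

Lemma tmulPl u c t v : tmul (c *: t + v) u = c *: tmul t u + tmul v u.
Proof. by rewrite !tmul_def; exact: tens_lift_is_linear (tmulp_bilin u) c t v. Qed.

Lemma tmulPr t c u v : tmul t (c *: u + v) = c *: tmul t u + tmul t v.
Proof.
rewrite !tmul_def -[RHS]tens_lift_linf.
by apply: eq_tens_lift => a b; exact: tmulpP.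
Qed.

Lemma tmulDl : left_distributive tmul +%R.
Proof. by move=> t v u; have := tmulPl u 1 t v; rewrite !scale1r. Qed.

Lemma tmulDr : right_distributive tmul +%R.
Proof. by move=> t u v; have := tmulPr t 1 u v; rewrite !scale1r. Qed.

Lemma tmul0l u : tmul 0 u = 0.
Proof. by apply: (addrI (tmul 0 u)); rewrite -tmulDl !addr0. Qed.

Lemma tmul0r u : tmul u 0 = 0.
Proof. by apply: (addrI (tmul u 0)); rewrite -tmulDr !addr0. Qed.

Lemma tscaleAl (c : K) t u : c *: tmul t u = tmul (c *: t) u.
Proof. by rewrite -[c *: t]addr0 tmulPl tmul0l addr0. Qed.

Lemma tscaleAr (c : K) t u : c *: tmul t u = tmul t (c *: u).
Proof. by rewrite -[c *: u]addr0 tmulPr tmul0r addr0. Qed.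

Lemma tmulA : associative tmul.
Proof.
move=> t u v; elim/tens_ind: t => [t t' ht ht'|c t ht|a b].
- by rewrite (tmulDl t) ht ht' (tmulDl t) (tmulDl (tmul t u)).
- by rewrite -(tscaleAl c t) ht -(tscaleAl c t) -(tscaleAl c (tmul t u)).
elim/tens_ind: u => [u u' hu hu'|c u hu|a' b'].
- rewrite (tmulDl u) (tmulDr _ (tmul u v)) hu hu' (tmulDr _ u).
  by rewrite (tmulDl (tmul _ u)).
- rewrite -(tscaleAl c u) -(tscaleAr c _ (tmul u v)) hu -(tscaleAr c _ u).
  by rewrite -(tscaleAl c (tmul _ u)).
elim/tens_ind: v => [v v' hv hv'|c v hv|a'' b''].
- by rewrite (tmulDr _ v) (tmulDr _ (tmul _ v)) hv hv' (tmulDr _ v).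
- by rewrite -(tscaleAr c _ v) -(tscaleAr c _ (tmul _ v)) hv -(tscaleAr c _ v).
by rewrite !tmulE !mulrA.
Qed.

Lemma tmul1l : left_id (1 ⊗ 1) tmul.
Proof.
elim/tens_ind => [t u ht hu|c t ht|a b].
- by rewrite (tmulDr _ t) ht hu.
- by rewrite -(tscaleAr c _ t) ht.
by rewrite tmulE !mul1r.
Qed.

Lemma tmul1r : right_id (1 ⊗ 1) tmul.
Proof.
elim/tens_ind => [t u ht hu|c t ht|a b].
- by rewrite (tmulDl t) ht hu.
- by rewrite -(tscaleAl c t) ht.
by rewrite tmulE !mulr1.
Qed.

HB.instance Definition _ := GRing.Zmodule_isPzRing.Build (tens A B)
  tmulA tmul1l tmul1r tmulDl tmulDr.

End TensorAlgebra.

Section TensorMaps.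
Variable K : fieldType.

Definition tens_map (A A' B B' : lmodType K) (f : A -> A') (g : B -> B') :
  A ⊗ B -> A' ⊗ B' := tens_lift (fun a b => f a ⊗ g b).

Definition tens_assoc (A B C : lmodType K) : A ⊗ B ⊗ C -> A ⊗ (B ⊗ C) :=
  tens_lift (fun t c => tens_lift (fun a b => a ⊗ (b ⊗ c)) t).

Definition tens_mul (A : algType K) : A ⊗ A -> A :=
  tens_lift (fun a b => a * b).

(* f ⊗ id and id ⊗ f followed by the identifications K ⊗ A = A = A ⊗ K.       *)
Definition tens_evall (A : lmodType K) (f : A -> K) : A ⊗ A -> A :=
  tens_lift (fun a b => f a *: b).

Definition tens_evalr (A : lmodType K) (f : A -> K) : A ⊗ A -> A :=
  tens_lift (fun a b => f b *: a).

Lemma tens_mapE (A A' B B' : lmodType K)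
    (f : {linear A -> A'}) (g : {linear B -> B'}) a b :
  tens_map f g (a ⊗ b) = f a ⊗ g b.
Proof.
apply: tens_liftE; split=> [y|x] c u v /=.
  by rewrite linearP linearPl.
by rewrite linearP linearPr.
Qed.

Lemma tens_assocE (A B C : lmodType K) (a : A) (b : B) (c : C) :
  tens_assoc ((a ⊗ b) ⊗ c) = a ⊗ (b ⊗ c).
Proof.
have h (z : C) : bilinear_for *:%R *:%R
    (fun (x : A) (y : B) => x ⊗ (y ⊗ z)).
  by split=> [y|x] k u v /=; rewrite !(linearPl, linearPr).
rewrite /tens_assoc tens_liftE; first exact: (tens_liftE (h c)).
split=> [z|t] k u v /=; first exact: tens_lift_is_linear.
rewrite -[RHS]tens_lift_linf; apply: eq_tens_lift => x y.
by rewrite !linearPr.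
Qed.

Lemma tens_mulE (A : algType K) (a b : A) : tens_mul (a ⊗ b) = a * b.
Proof.
apply: tens_liftE; split=> [y|x] c u v /=.
  by rewrite mulrDl scalerAl.
by rewrite mulrDr scalerAr.
Qed.

Lemma tens_evallE (A : lmodType K) (f : {scalar A}) a b :
  tens_evall f (a ⊗ b) = f a *: b.
Proof.
apply: tens_liftE; split=> [y|x] c u v /=.
  by rewrite linearP scalerDl scalerA.
by rewrite scalerDr !scalerA mulrC.
Qed.

Lemma tens_evalrE (A : lmodType K) (f : {scalar A}) a b :
  tens_evalr f (a ⊗ b) = f b *: a.
Proof.
apply: tens_liftE; split=> [y|x] c u v /=.
  by rewrite scalerDr !scalerA mulrC.
by rewrite linearP scalerDl scalerA.
Qed.

End TensorMaps.

Record hopf_axioms (K : fieldType) (A : algType K)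
    (Delta : {lrmorphism A -> A ⊗ A | *:%R})
    (epsilon : {lrmorphism A -> K | *%R})
    (S : {linear A -> A}) : Prop := HopfAxioms {
  hopf_coassoc x :
    tens_assoc (tens_map Delta idfun (Delta x)) = tens_map idfun Delta (Delta x);
  hopf_counitl x : tens_evall epsilon (Delta x) = x;
  hopf_counitr x : tens_evalr epsilon (Delta x) = x;
  hopf_antipodel x :
    tens_mul (tens_map S idfun (Delta x)) = epsilon x *: 1;
  hopf_antipoder x :
    tens_mul (tens_map idfun S (Delta x)) = epsilon x *: 1
}.

Definition antimultiplicative (R : pzRingType) (f : R -> R) :=
  f 1 = 1 /\ forall x y, f (x * y) = f y * f x.

(* Free unital associative algebra on I: the monoid algebra of the free       *)
(* monoid of words in I.                                                      *)
Section FreeAlgebra.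
Variables (K : fieldType) (I : choiceType).

Definition freealg := {malg K[fmonom I]}.

HB.instance Definition _ := GRing.Lmodule.on freealg.

Definition fmul : freealg -> freealg -> freealg :=
  locked_with modquot_key (fun x y : {malg K[fmonom I]} => x * y).

Definition fone : freealg := (1 : {malg K[fmonom I]}).

Lemma fmulE (x y : freealg) : fmul x y = (x * y : {malg K[fmonom I]}).
Proof. by rewrite /fmul; case: modquot_key. Qed.

Lemma fmulA : associative fmul.
Proof. by move=> x y z; rewrite !fmulE mulrA. Qed.
Lemma fmul1l : left_id fone fmul.
Proof. by move=> x; rewrite fmulE mul1r. Qed.
Lemma fmul1r : right_id fone fmul.
Proof. by move=> x; rewrite fmulE mulr1. Qed.
Lemma fmulDl : left_distributive fmul +%R.
Proof. by move=> x y z; rewrite !fmulE mulrDl. Qed.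
Lemma fmulDr : right_distributive fmul +%R.
Proof. by move=> x y z; rewrite !fmulE mulrDr. Qed.
Lemma fone_neq0 : fone != 0.
Proof. exact: (oner_neq0 {malg K[fmonom I]}). Qed.

HB.instance Definition _ := GRing.Zmodule_isNzRing.Build freealg
  fmulA fmul1l fmul1r fmulDl fmulDr fone_neq0.

Lemma fscaleAl (c : K) (x y : freealg) : c *: fmul x y = fmul (c *: x) y.
Proof. by rewrite !fmulE; exact: (@scalerAl K {malg K[fmonom I]}). Qed.

HB.instance Definition _ := GRing.Lmodule_isLalgebra.Build K freealg fscaleAl.

Lemma fscaleAr (c : K) (x y : freealg) : c *: fmul x y = fmul x (c *: y).
Proof.
rewrite !fmulE.
have cC (g : {malg K[fmonom I]}) : g * c%:MP = c *: g.
  rewrite malgM_def fgmulgU malgZ_def; apply: eq_bigr => k _.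
  by rewrite mulm1 mulrC.
have -> : c *: y = c%:MP * (y : {malg K[fmonom I]}) :> {malg K[fmonom I]}.
  by rewrite mul_malgC.
by rewrite mulrA cC (@scalerAl K {malg K[fmonom I]}).
Qed.

HB.instance Definition _ := GRing.Lalgebra_isAlgebra.Build K freealg fscaleAr.

Definition freegen : I -> freealg :=
  locked_with modquot_key (fun i => << fmu i >>).

Lemma freegenE i : freegen i = << fmu i >>.
Proof. by rewrite /freegen; case: modquot_key. Qed.

End FreeAlgebra.

(* The index set N = {1, 2, 3, ...}.                                          *)
Definition Npos := {i : nat | (0 < i)%N}.

Section Presentation.

Inductive gen : Type :=
| GenE of Npos
| GenF of Npos
| GenW of Npos
| GenWV of Npos      (* w_i^-1 *)
| GenW' of Npos
| GenW'V of Npos.   (* w'_i^-1 *)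

Definition gen_code (g : gen) : nat * Npos :=
  match g with
  | GenE i => (0%N, i) | GenF i => (1%N, i) | GenW i => (2%N, i)
  | GenWV i => (3%N, i) | GenW' i => (4%N, i) | GenW'V i => (5%N, i)
  end.

Definition gen_decode (c : nat * Npos) : gen :=
  let: (n, i) := c in
  match n with
  | 0%N => GenE i | 1%N => GenF i | 2%N => GenW i
  | 3%N => GenWV i | 4%N => GenW' i | _ => GenW'V i
  end.

Lemma gen_codeK : cancel gen_code gen_decode. Proof. by case. Qed.

HB.instance Definition _ := Countable.copy gen (can_type gen_codeK).

Definition is_toral (g : gen) : bool :=
  match g with GenE _ | GenF _ => false | _ => true end.

(* <i, j> = <alpha_i, alpha_j> *)
Definition aform (i j : Npos) : int :=
  if val i == val j then 1 else if val j == (val i).+1 then -1 else 0.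

Variables (K : fieldType) (r s : K).

Local Notation F := (freealg K gen).
Local Notation e i := (freegen K (GenE i)).
Local Notation f i := (freegen K (GenF i)).
Local Notation w i := (freegen K (GenW i)).
Local Notation wV i := (freegen K (GenWV i)).
Local Notation w' i := (freegen K (GenW' i)).
Local Notation w'V i := (freegen K (GenW'V i)).

Variant Urs_rel : F -> F -> Prop :=
| RelTC g h of is_toral g & is_toral h :
    Urs_rel (freegen K g * freegen K h) (freegen K h * freegen K g)
| RelWV i : Urs_rel (w i * wV i) 1
| RelVW i : Urs_rel (wV i * w i) 1
| RelW'V i : Urs_rel (w' i * w'V i) 1
| RelVW' i : Urs_rel (w'V i * w' i) 1
| RelWE i j :
    Urs_rel (w i * e j)
            ((r ^ aform j i * s ^ (- aform i j)) *: (e j * w i))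
| RelW'E i j :
    Urs_rel (w' i * e j)
            ((r ^ (- aform i j) * s ^ aform j i) *: (e j * w' i))
| RelWF i j :
    Urs_rel (w i * f j)
            ((r ^ (- aform j i) * s ^ aform i j) *: (f j * w i))
| RelW'F i j :
    Urs_rel (w' i * f j)
            ((r ^ aform i j * s ^ (- aform j i)) *: (f j * w' i))
| RelEF i j :
    Urs_rel (e i * f j - f j * e i)
            ((i == j)%:R *: ((r - s)^-1 *: (w i - w' i)))
| RelEE i j of (1 < `|(val i)%:Z - (val j)%:Z|)%R :
    Urs_rel (e i * e j - e j * e i) 0
| RelFF i j of (1 < `|(val i)%:Z - (val j)%:Z|)%R :
    Urs_rel (f i * f j - f j * f i) 0
| RelSerreE1 i j of val j = (val i).+1 :
    Urs_rel (e i ^+ 2 * e j - (r + s) *: (e i * e j * e i)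
             + (r * s) *: (e j * e i ^+ 2)) 0
| RelSerreE2 i j of val j = (val i).+1 :
    Urs_rel (e i * e j ^+ 2 - (r + s) *: (e j * e i * e j)
             + (r * s) *: (e j ^+ 2 * e i)) 0
| RelSerreF1 i j of val j = (val i).+1 :
    Urs_rel (f i ^+ 2 * f j - (r^-1 + s^-1) *: (f i * f j * f i)
             + (r * s)^-1 *: (f j * f i ^+ 2)) 0
| RelSerreF2 i j of val j = (val i).+1 :
    Urs_rel (f i * f j ^+ 2 - (r^-1 + s^-1) *: (f j * f i * f j)
             + (r * s)^-1 *: (f j ^+ 2 * f i)) 0.

Definition Urs := algquot Urs_rel.

HB.instance Definition _ := GRing.Lmodule.on Urs.
HB.instance Definition _ := GRing.PzRing.on Urs.

Definition Ugen (g : gen) : Urs := aqpi Urs_rel (freegen K g).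

(* Urs is not the zero ring: the augmentation e_i, f_i |-> 0, w |-> 1 of the  *)
(* free algebra vanishes on the relations.                                    *)
Let aug_gen (m : fmonom gen) : K := \prod_(g <- (m : seq gen)) (is_toral g)%:R.

Let aug_gen_morph : mmorphism aug_gen.
Proof.
split=> [x y|]; first by rewrite /aug_gen fmM big_cat.
by rewrite /aug_gen fm1 big_nil.
Qed.

HB.instance Definition _ := isMultiplicative.Build (fmonom gen) K aug_gen
  aug_gen_morph.

Lemma augmentation : {aug : {lrmorphism F -> K | *%R} |
  forall g, aug (freegen K g) = (is_toral g)%:R}.
Proof.
pose aug (x : F) : K := mmap idfun aug_gen (x : {malg K[fmonom gen]}).
have augD : zmod_morphism aug.
  by move=> x y; exact: (rmorphB (mmap idfun aug_gen)).
have augM : monoid_morphism aug.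
  split=> [|x y]; first exact: (rmorph1 (mmap idfun aug_gen)).
  by rewrite -[x * y]/(fmul x y) fmulE; exact: (rmorphM (mmap idfun aug_gen)).
have augZ : scalable_for *%R aug.
  by move=> c x; exact: (mmap_is_linear (h := aug_gen)).
pose A1 := GRing.isZmodMorphism.Build _ _ aug augD.
pose A2 := GRing.isMonoidMorphism.Build _ _ aug augM.
pose A3 := GRing.isScalable.Build _ _ _ _ aug augZ.
pose L : {lrmorphism F -> K | *%R} := HB.pack aug A1 A2 A3.
by exists L => g; rewrite freegenE /= /aug mmapU /= mul1r /aug_gen fmU big_seq1.
Qed.

Lemma aug_rel (aug : {lrmorphism F -> K | *%R}) x y :
  (forall g, aug (freegen K g) = (is_toral g)%:R) ->
  Urs_rel x y -> aug x = aug y.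
Proof.
move=> augU.
have augB u v : aug (u - v) = aug u - aug v by exact: rmorphB.
have augD u v : aug (u + v) = aug u + aug v by exact: rmorphD.
have augM u v : aug (u * v) = aug u * aug v by exact: rmorphM.
have augZ c u : aug (c *: u) = c * aug u by exact: linearZ.
have aug0 : aug 0 = 0 by exact: rmorph0.
have aug1 : aug 1 = 1 by exact: rmorph1.
case=> [g h _ _|i|i|i|i|i j|i j|i j|i j|i j|i j _|i j _|i j _|i j _|i j _|i j _].
- by rewrite !augM mulrC.
- by rewrite augM !augU aug1 mulr1.
- by rewrite augM !augU aug1 mulr1.
- by rewrite augM !augU aug1 mulr1.
- by rewrite augM !augU aug1 mulr1.
- by rewrite augZ !augM !augU /= !(mulr0, mul0r).
- by rewrite augZ !augM !augU /= !(mulr0, mul0r).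
- by rewrite augZ !augM !augU /= !(mulr0, mul0r).
- by rewrite augZ !augM !augU /= !(mulr0, mul0r).
- by rewrite !augZ !augB !augM !augU /= !(mulr0, mul0r, subrr).
- by rewrite augB !augM aug0 mulrC subrr.
- by rewrite augB !augM aug0 mulrC subrr.
all: by rewrite ?expr2 augD augB !augZ !augM !augU aug0 /= !(mulr0, mul0r) subrr addr0.
Qed.

Lemma Urs_nonzero : (1 : Urs) != 0.
Proof.
have [aug augU] := augmentation.
apply/eqP => h1; have : mqpi (ideal_rel Urs_rel) 1 = 0 := h1.
rewrite -(mqpi0 (ideal_rel Urs_rel)) => /mqpi_eq; rewrite subr0 => h.
suff : aug 1 = 0 by rewrite rmorph1; apply/eqP/oner_neq0.
elim: h => [|c _ _ v [a x y b hxy] _ ih]; first exact: rmorph0.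
rewrite linearD linearZ rmorphB /= ih addr0 !rmorphM /= (aug_rel augU hxy).
by rewrite subrr mulr0.
Qed.

HB.instance Definition _ := GRing.PzSemiRing_isNonZero.Build Urs Urs_nonzero.
HB.instance Definition _ := GRing.Lmodule_isLalgebra.Build K Urs
  (@aqscaleAl _ _ Urs_rel).
HB.instance Definition _ := GRing.Lalgebra_isAlgebra.Build K Urs
  (@aqscaleAr _ _ Urs_rel).

End Presentation.

(* Q(r, s), as the fraction field of Q[r][s].                                 *)
Definition Qrs : fieldType := {fraction {poly {poly rat}}}.
Definition rvar : Qrs := tofrac ('X : {poly rat})%:P.
Definition svar : Qrs := tofrac ('X : {poly {poly rat}}).

Definition Usl : algType Qrs := Urs rvar svar.

Section Generators.
Variable i : Npos.
Definition ue : Usl := Ugen rvar svar (GenE i).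
Definition uf : Usl := Ugen rvar svar (GenF i).
Definition uw : Usl := Ugen rvar svar (GenW i).
Definition uwV : Usl := Ugen rvar svar (GenWV i).
Definition uw' : Usl := Ugen rvar svar (GenW' i).
Definition uw'V : Usl := Ugen rvar svar (GenW'V i).
End Generators.

Definition comul_formulas (Delta : Usl -> Usl ⊗ Usl) : Prop :=
  forall i,
  [/\ Delta (uw i) = uw i ⊗ uw i /\ Delta (uwV i) = uwV i ⊗ uwV i,
      Delta (uw' i) = uw' i ⊗ uw' i /\ Delta (uw'V i) = uw'V i ⊗ uw'V i,
      Delta (ue i) = ue i ⊗ 1 + uw i ⊗ ue i
    & Delta (uf i) = 1 ⊗ uf i + uf i ⊗ uw' i].

Definition counit_formulas (epsilon : Usl -> Qrs) : Prop :=
  forall i,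
  [/\ epsilon (uw i) = 1 /\ epsilon (uwV i) = 1,
      epsilon (uw' i) = 1 /\ epsilon (uw'V i) = 1,
      epsilon (ue i) = 0
    & epsilon (uf i) = 0].

Definition antipode_formulas (S : Usl -> Usl) : Prop :=
  forall i,
  [/\ S (uw i) = uwV i /\ S (uwV i) = uw i,
      S (uw' i) = uw'V i /\ S (uw'V i) = uw' i,
      S (ue i) = - (uwV i * ue i)
    & S (uf i) = - (uf i * uw'V i)].

(* Main.v *)
Require Import Defs.
From mathcomp Require Import all_boot all_order all_algebra.
From HB Require Import structures.
From mathcomp Require Import finmap monalg zify ring.
Set Implicit Arguments.
Unset Strict Implicit.
Unset Printing Implicit Defensive.
Import GRing.Theory.
Local Open Scope ring_scope.

(** U_{r,s}(sl_infinity) is given by generators and relations, so a linear map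
    on it that turns products into products (or into reversed products) exists
    as soon as the prescribed images of the generators satisfy the relations,
    and it is determined by these images ([Urs_lift], [generated_morph_eq]).
    Everything is done over an arbitrary field with nonzero parameters r, s.
    The three targets are the algebra U ⊗ U for the comultiplication, the
    ground field for the counit, and the converse algebra of U for the
    antipode, which is antimultiplicative.

    Checking the relations rests on two observations. First, the torus elements
    commute with the e_j and the f_j up to the scalars [wt] and their inverses.
    Since these scalars come in inverse pairs, the mixed terms in [e_i, f_j]
    cancel, and since they are 1 for |i - j| > 1, commuting pairs are sent to
    commuting pairs. Second, each quantum Serre relation is an iterated q-commutator
    [x, [x, y]_q]_p = 0. In Delta (x) = a + b the two summands q-commute, and the
    scalars are exactly those for which [x, [x, y]_q]_p is additive
    ([serreD]); they are also those for which replacing x by w^-1 x and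
    reversing products preserves the relation ([serre_twist]). All four
    families of Serre relations are instances, for
    (p, q) = (r, s) or (s^-1, r^-1).

    Given the maps, the Hopf axioms are equalities of linear maps on U. Both
    sides of coassociativity and of the counit axioms are multiplicative, so
    they are compared on generators. The antipode convolutions S * id and
    id * S are not multiplicative, but a scalar value can be pulled through a
    product ([antil_mul], [antir_mul]), so the generators again suffice. *)

(** * q-commutators and quantum Serre relations *)

Section QCommutator.
Variables (K : fieldType) (A : algType K).
Implicit Types (c d p q : K) (x y z : A).

Definition qcomm c x y := x * y = c *: (y * x).
Definition qbr c x y : A := x * y - c *: (y * x).

Lemma qbr_eq0 c x y : qcomm c x y -> qbr c x y = 0.
Proof. by move=> h; rewrite /qbr h subrr. Qed.

Lemma qcommMr c d x y z : qcomm c x y -> qcomm d x z -> qcomm (c * d) x (y * z).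
Proof.
move=> hy hz; rewrite /qcomm mulrA hy -scalerAl -[y * x * z]mulrA hz -scalerAr scalerA.
by rewrite mulrA.
Qed.

Lemma qcommMl c d x y z : qcomm c x z -> qcomm d y z -> qcomm (c * d) (x * y) z.
Proof.
move=> hx hy; rewrite /qcomm -[x * y * z]mulrA hy -scalerAr [x * (z * y)]mulrA hx -scalerAl scalerA.
by rewrite mulrC mulrA.
Qed.

Lemma qcomm_sym c x y : c != 0 -> qcomm c x y -> qcomm c^-1 y x.
Proof. by move=> c0 h; rewrite /qcomm h scalerA mulVf ?scale1r. Qed.

(** Passing to the inverse of x moves it to the other side of y with the same
    scalar. *)
Lemma qcomm_inv c x v y : x * v = 1 -> v * x = 1 -> qcomm c x y -> qcomm c y v.
Proof.
move=> xv vx h; rewrite /qcomm -[y]mul1r -[in LHS]vx -[v * x * y]mulrA h.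
by rewrite -!(scalerAl, scalerAr) -!mulrA xv mulr1 mul1r.
Qed.

Lemma qcomm_scale c d x y : qcomm c x y -> qcomm c x (d *: y).
Proof. by move=> h; rewrite /qcomm -scalerAr h -scalerAl !scalerA mulrC. Qed.

Lemma qcommD c x y z : qcomm c x y -> qcomm c x z -> qcomm c x (y + z).
Proof. by rewrite /qcomm mulrDr mulrDl scalerDr => -> ->. Qed.

Lemma qcomm_qbr c d p x y z :
  qcomm c x y -> qcomm d x z -> qcomm (c * d) x (qbr p y z).
Proof.
move=> hy hz; rewrite /qbr -scaleNr; apply: qcommD; first exact: qcommMr.
by apply: qcomm_scale; rewrite mulrC; exact: qcommMr.
Qed.

Lemma qcomm_qbrl c d p x y z :
  qcomm c x z -> qcomm d y z -> qcomm (c * d) (qbr p x y) z.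
Proof.
move=> hx hy; rewrite /qbr /qcomm mulrBl mulrBr scalerBr -!(scalerAl, scalerAr).
rewrite (qcommMl hx hy) (qcommMl hy hx) !scalerA.
by rewrite [d * c]mulrC [p * _]mulrC.
Qed.

Lemma qbrDl c x y z : qbr c (x + y) z = qbr c x z + qbr c y z.
Proof. by rewrite /qbr mulrDl mulrDr scalerDr opprD addrACA. Qed.

Lemma qbrDr c x y z : qbr c x (y + z) = qbr c x y + qbr c x z.
Proof. by rewrite /qbr mulrDl mulrDr scalerDr opprD addrACA. Qed.

Lemma qbrZr c d x y : qbr c x (d *: y) = d *: qbr c x y.
Proof. by rewrite /qbr -scalerAr -scalerAl scalerBr !scalerA mulrC. Qed.

Lemma qbrZl c d x y : qbr c (d *: x) y = d *: qbr c x y.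
Proof. by rewrite /qbr -scalerAr -scalerAl scalerBr !scalerA mulrC. Qed.

Lemma qbr0l c x : qbr c 0 x = 0.
Proof. by rewrite /qbr mulr0 mul0r scaler0 subr0. Qed.

Lemma qbrE_l c d x y : qcomm d y x -> qbr c x y = (1 - c * d) *: (x * y).
Proof. by rewrite /qbr => ->; rewrite scalerA scalerBl scale1r. Qed.

Lemma qbr1E x y : qbr 1 x y = x * y - y * x.
Proof. by rewrite /qbr scale1r. Qed.

Lemma qbrD_diag c a1 a2 b1 b2 : qcomm c a1 b2 -> qcomm c b1 a2 ->
  qbr c (a1 + b1) (a2 + b2) = qbr c a1 a2 + qbr c b1 b2.
Proof.
move=> ab ba; rewrite qbrDl (qbrDr c a1) (qbrDr c b1).
by rewrite (qbr_eq0 ab) (qbr_eq0 ba) addr0 add0r.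
Qed.

Definition serre p q x y := qbr p x (qbr q x y).

Lemma serreE p q x y :
  serre p q x y =
  x ^+ 2 * y - (p + q) *: (x * y * x) + (p * q) *: (y * x ^+ 2).
Proof.
rewrite /serre /qbr mulrBr mulrBl -scalerAr -scalerAl scalerBr scalerA.
rewrite opprB !expr2 !mulrA scalerDl opprD !addrA [LHS]addrAC.
by congr (_ + _); rewrite addrAC.
Qed.

Lemma serreC p q x y : serre p q x y = serre q p x y.
Proof. by rewrite !serreE addrC [p + q]addrC [p * q]mulrC addrC. Qed.

(** The Serre relation that is quadratic in the second generator is, up to a
    unit, a Serre relation for the exchanged generators and inverse
    parameters. *)
Lemma serre_rev p q x y : p != 0 -> q != 0 ->
  y * x ^+ 2 - (p + q) *: (x * y * x) + (p * q) *: (x ^+ 2 * y)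
    = (p * q) *: serre q^-1 p^-1 x y.
Proof.
move=> p0 q0; rewrite serreE scalerDr scalerBr !scalerA.
have -> : p * q * (q^-1 * p^-1) = 1 by field; rewrite q0 p0.
have -> : p * q * (q^-1 + p^-1) = p + q by field; rewrite q0 p0.
by rewrite scale1r [RHS]addrC addrA addrAC.
Qed.

Lemma serreZ p q c d x y :
  serre p q (c *: x) (d *: y) = (c ^+ 2 * d) *: serre p q x y.
Proof. by rewrite /serre !(qbrZl, qbrZr) !scalerA; congr (_ *: _); ring. Qed.

Lemma serre0 p q y : serre p q 0 y = 0.
Proof. by rewrite /serre qbr0l. Qed.

(** The scalars with which wx and wy move past x and y in every Serre relation
    of the algebra: [serreD] needs them between the two summands of the
    coproducts. *)
Definition serre_weights p q x y wx wy :=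
  [/\ qcomm q wx y, qcomm p^-1 wy x & qcomm (p / q) wx x].

(** The q-commutator [a1 + b1, a2 + b2]_q has the single cross term
    (1 - q / p) a1 b2, because b1 a2 = q a2 b1. Commuting once more with
    a1 + b1, this term contributes (1 - q / p) (p / q) a1 [b1, b2]_q, and
    [b1, b2]_q contributes (1 - p / q) a1 [b1, b2]_q: the sum vanishes. *)
Lemma serreD p q a1 a2 b1 b2 : p != 0 -> q != 0 ->
  serre_weights p q a1 a2 b1 b2 ->
  serre p q (a1 + b1) (a2 + b2) = serre p q a1 a2 + serre p q b1 b2.
Proof.
move=> p0 q0 [h12 h21 h11].
have inner : qbr q (a1 + b1) (a2 + b2) =
    qbr q a1 a2 + (1 - q / p) *: (a1 * b2) + qbr q b1 b2.
  rewrite qbrDl (qbrDr q a1) (qbrDr q b1) (qbr_eq0 h12) add0r.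
  by rewrite (qbrE_l q h21).
have ba : qbr p b1 (qbr q a1 a2) = 0.
  by apply: qbr_eq0; have := qcomm_qbr q h11 h12; rewrite divfK.
have ab : qcomm q^-1 (qbr q b1 b2) a1.
  by have := qcomm_qbrl q h11 h21; rewrite (mulrAC p) mulfV // mul1r.
have aab : qbr p a1 (a1 * b2) = 0.
  by rewrite /qbr -mulrA h21 -scalerAr scalerA mulfV // scale1r subrr.
have bab : qbr p b1 (a1 * b2) = (p / q) *: (a1 * qbr q b1 b2).
  rewrite /qbr mulrBr mulrA h11 -!(scalerAl, scalerAr) scalerBr scalerA divfK //.
  by rewrite -!mulrA.
rewrite /serre inner qbrDl 2!(qbrDr p a1) 2!(qbrDr p b1) !qbrZr.
rewrite ba aab bab (qbrE_l p ab) scaler0 addr0 add0r scalerA addrA.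
rewrite -(addrA (qbr p a1 _)) -scalerDl.
rewrite (_ : 1 - p / q + (1 - q / p) * (p / q) = 0).
  by rewrite scale0r addr0.
by field; rewrite q0.
Qed.
End QCommutator.

(** * The converse algebra *)

Section Converse.
Variables (K : fieldType) (A : algType K).

HB.instance Definition _ := GRing.Lmodule.on A^c.

Let conv_scaleAl (k : K) (x y : A^c) : k *: (x * y) = (k *: x : A^c) * y.
Proof. exact: (scalerAr k (y : A) (x : A)). Qed.

HB.instance Definition _ := GRing.Lmodule_isLalgebra.Build K A^c conv_scaleAl.

Let conv_scaleAr (k : K) (x y : A^c) : k *: (x * y) = x * (k *: y : A^c).
Proof. exact: (scalerAl k (y : A) (x : A)). Qed.

HB.instance Definition _ := GRing.Lalgebra_isAlgebra.Build K A^c conv_scaleAr.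

(** In the converse algebra the q-commutator of v x and w y is
    w y v x - c v x w y, and moving v and w to the left rescales both terms,
    which changes the parameter of the q-commutator of x and y. *)
Lemma qbr_twist c d d' (x y v w : A) : c * d' != 0 -> v * w = w * v ->
  qcomm d y v -> qcomm d' x w ->
  qbr c (v * x : A^c) (w * y) =
    - (c * d') *: (v * w * qbr (d / (c * d')) x y).
Proof.
move=> cd0 vw hy hx.
have -> : qbr c (v * x : A^c) (w * y) = w * y * (v * x) - c *: (v * x * (w * y)).
  by [].
have -> : w * y * (v * x) = d *: (v * w * (y * x)).
  by rewrite vw -mulrA (mulrA y) hy -!(scalerAl, scalerAr) !mulrA.
have -> : v * x * (w * y) = d' *: (v * w * (x * y)).
  by rewrite -mulrA (mulrA x) hx -!(scalerAl, scalerAr) !mulrA.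
rewrite /qbr mulrBr -scalerAr scalerBr !scalerA mulNr !scaleNr opprK addrC.
by rewrite (mulrC _ (d / _)) divfK.
Qed.

(** The inner twist turns [x, y]_q into [x, y]_p and the outer one turns the
    parameter p into q, so that p and q get exchanged, which is harmless by
    [serreC]; the two rescalings - q / p and - p / q cancel. *)
Lemma serre_twist p q (x y v w : A) : p != 0 -> q != 0 -> v * w = w * v ->
  qcomm q y v -> qcomm p^-1 x w -> qcomm (p / q) x v ->
  serre p q (v * x : A^c) (w * y) = v * (v * w) * serre p q x y.
Proof.
move=> p0 q0 vw yv xw xv; rewrite /serre (qbr_twist _ vw yv xw); last first.
  by rewrite mulf_neq0 ?invr_eq0.
rewrite qbrZr.
have -> : q / (q * p^-1) = p by field; rewrite p0 q0.
have zv : qcomm p (qbr p x y) v.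
  by have := qcomm_qbrl p xv yv; rewrite divfK.
have xvw : qcomm q^-1 x (v * w).
  by have := qcommMr xv xw; rewrite mulrAC mulfV // mul1r.
rewrite (qbr_twist _ _ zv xvw); first last.
- by rewrite -mulrA -vw.
- by rewrite mulf_neq0 ?invr_eq0.
have -> : p / (p * q^-1) = q by field; rewrite p0 q0.
rewrite scalerA mulrNN (_ : _ * _ = 1) ?scale1r; last by field; rewrite p0 q0.
by rewrite -/(serre q p x y) serreC.
Qed.

End Converse.

(** * Linear maps on tensor products *)

Section TensorLinear.
Variables (K : fieldType).

Lemma tens_map_is_linear (A A' B B' : lmodType K)
    (f : {linear A -> A'}) (g : {linear B -> B'}) : linear (tens_map f g).
Proof.
by apply: tens_lift_is_linear; split=> [y|x] c u v /=;
  rewrite linearP ?linearPl ?linearPr.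
Qed.

Lemma tens_assoc_is_linear (A B C : lmodType K) : linear (@tens_assoc K A B C).
Proof.
have h (z : C) : bilinear_for *:%R *:%R
    (fun (x : A) (y : B) => x ⊗ (y ⊗ z)).
  by split=> [y|x] k u v /=; rewrite !(linearPl, linearPr).
apply: tens_lift_is_linear.
split=> [z|t] k u v /=; first exact: tens_lift_is_linear.
rewrite -[RHS]tens_lift_linf; apply: eq_tens_lift => x y.
by rewrite !linearPr.
Qed.

Lemma tens_mul_is_linear (A : algType K) : linear (@tens_mul K A).
Proof.
apply: tens_lift_is_linear; split=> [y|x] c u v /=.
  by rewrite mulrDl scalerAl.
by rewrite mulrDr scalerAr.
Qed.

Lemma tens_evall_is_linear (A : lmodType K) (f : {scalar A}) :
  linear (tens_evall f).
Proof.
apply: tens_lift_is_linear; split=> [y|x] c u v /=.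
  by rewrite linearP scalerDl scalerA.
by rewrite scalerDr !scalerA mulrC.
Qed.

Lemma tens_evalr_is_linear (A : lmodType K) (f : {scalar A}) :
  linear (tens_evalr f).
Proof.
apply: tens_lift_is_linear; split=> [y|x] c u v /=.
  by rewrite scalerDr !scalerA mulrC.
by rewrite linearP scalerDl scalerA.
Qed.

Lemma lin0 (V1 V2 : lmodType K) (f : V1 -> V2) : linear f -> f 0 = 0.
Proof. by move=> lf; have := lf (-1) 0 0; rewrite scaler0 addr0 scaleN1r addNr. Qed.

Lemma linD (V1 V2 : lmodType K) (f : V1 -> V2) :
  linear f -> {morph f : x y / x + y}.
Proof. by move=> lf x y; have := lf 1 x y; rewrite !scale1r. Qed.

Lemma linZ (V1 V2 : lmodType K) (f : V1 -> V2) :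
  linear f -> forall c, {morph f : x / c *: x}.
Proof. by move=> lf c x; rewrite -[c *: x]addr0 lf lin0 // addr0. Qed.

Lemma linear_comp (V1 V2 V3 : lmodType K) (f : V2 -> V3) (g : V1 -> V2) :
  linear f -> linear g -> linear (fun x => f (g x)).
Proof. by move=> lf lg c x y; rewrite lg lf. Qed.

Lemma tens_linear_eq (A B W : lmodType K) (f g : A ⊗ B -> W) :
  linear f -> linear g -> (forall a b, f (a ⊗ b) = g (a ⊗ b)) -> f =1 g.
Proof.
move=> lf lg e.
elim/tens_ind => [t u ht hu|c t ht|//]; first by rewrite !linD // ht hu.
by rewrite !linZ // ht.
Qed.

Lemma tens_mulr_linear (A B : algType K) (x : A ⊗ B) :
  linear (fun y : A ⊗ B => y * x).
Proof. by move=> c y z; exact: tmulPl. Qed.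

Lemma tens_mull_linear (A B : algType K) (x : A ⊗ B) :
  linear (fun y : A ⊗ B => x * y).
Proof. by move=> c y z; exact: tmulPr. Qed.

(** A product formula for linear maps out of a tensor product need only be
    checked on pure tensors. With three different maps it also covers
    (x y) ⊗ (c d) as a function of x and y, where the last tensor factor of
    each side is a different constant. *)
Lemma tens_multiplicative (A B : algType K) (W : lmodType K)
    (f f1 f2 : A ⊗ B -> W) (op : W -> W -> W) :
  linear f -> linear f1 -> linear f2 -> bilinear_for *:%R *:%R op ->
  (forall a b a' b',
     f ((a * a' : A) ⊗ (b * b' : B)) = op (f1 (a ⊗ b)) (f2 (a' ⊗ b'))) ->
  forall t u, f (t * u) = op (f1 t) (f2 u).
Proof.
move=> lf lf1 lf2 [opl opr] e t u.
move: t; apply: tens_linear_eq => [||a b].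
- exact: linear_comp lf (tens_mulr_linear u).
- by move=> c x y; rewrite lf1; exact: opl.
move: u; apply: tens_linear_eq => [||a' b'].
- exact: linear_comp lf (tens_mull_linear (a ⊗ b)).
- by move=> c x y; rewrite lf2; exact: opr.
by rewrite [_ * _]tmulE.
Qed.

(** The factorwise product on A ⊗ B for bilinear products on mere modules A and
    B: it yields the product of U ⊗ (U ⊗ U) for which both sides of
    coassociativity are multiplicative. *)
Section TensorOp.
Variables (A B : lmodType K) (opA : A -> A -> A) (opB : B -> B -> B).
Hypotheses (opA_bilinear : bilinear_for *:%R *:%R opA).
Hypotheses (opB_bilinear : bilinear_for *:%R *:%R opB).

Definition tens_op (t u : A ⊗ B) : A ⊗ B :=
  tens_lift (fun a b => tens_lift (fun a' b' => opA a a' ⊗ opB b b') u) t.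

Let opAl a a' c x : opA (c *: a + a') x = c *: opA a x + opA a' x.
Proof. exact: opA_bilinear.1. Qed.
Let opAr a a' c x : opA x (c *: a + a') = c *: opA x a + opA x a'.
Proof. exact: opA_bilinear.2. Qed.
Let opBl a a' c x : opB (c *: a + a') x = c *: opB a x + opB a' x.
Proof. exact: opB_bilinear.1. Qed.
Let opBr a a' c x : opB x (c *: a + a') = c *: opB x a + opB x a'.
Proof. exact: opB_bilinear.2. Qed.

Let inner_bilinear a b :
  bilinear_for *:%R *:%R (fun a' b' => opA a a' ⊗ opB b b').
Proof.
by split=> [y|x] c u v /=; [rewrite opAr linearPl | rewrite opBr linearPr].
Qed.

Let outer_bilinear u : bilinear_for *:%R *:%R
  (fun a b => tens_lift (fun a' b' => opA a a' ⊗ opB b b') u).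
Proof.
split=> [y|x] c v w /=; rewrite -[RHS]tens_lift_linf; apply: eq_tens_lift => a b.
  by rewrite opAl linearPl.
by rewrite opBl linearPr.
Qed.

Lemma tens_op_bilinear : bilinear_for *:%R *:%R tens_op.
Proof.
split=> [u|t] c v w /=; first exact: tens_lift_is_linear (outer_bilinear u) c v w.
rewrite -[RHS]tens_lift_linf; apply: eq_tens_lift => a b.
exact: tens_lift_is_linear (inner_bilinear a b) c v w.
Qed.

Lemma tens_opE a b a' b' : tens_op (a ⊗ b) (a' ⊗ b') = opA a a' ⊗ opB b b'.
Proof.
rewrite /tens_op (tens_liftE (outer_bilinear _)).
exact: tens_liftE (inner_bilinear a b) a' b'.
Qed.

End TensorOp.

End TensorLinear.

(** * Maps determined by generators *)

(** Generation is stated as an induction over left multiplications by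
    generators, which is the form that suits maps multiplicative for any
    product on the target. *)
Definition left_generated (K : fieldType) (I : Type) (A : algType K)
    (h : I -> A) :=
  forall P : A -> Prop, (forall x y, P x -> P y -> P (x + y)) ->
  (forall c x, P x -> P (c *: x)) -> P 1 -> (forall i x, P x -> P (h i * x)) ->
  forall x, P x.

Lemma generated_linear_eq (K : fieldType) (I : Type) (A : algType K) (h : I -> A)
    (X : lmodType K) (f g : A -> X) : left_generated h -> linear f -> linear g ->
  f 1 = g 1 -> (forall i x, f x = g x -> f (h i * x) = g (h i * x)) ->
  forall x, f x = g x.
Proof.
move=> h_gen lf lg e1 eg; apply: h_gen => [x y hx hy|c x hx||] //.
  by rewrite !linD // hx hy.
by rewrite !linZ // hx.
Qed.

(** The product on the target is arbitrary, so that this covers algebra maps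
    and, with the opposite product, antimultiplicative maps. *)
Lemma generated_morph_eq (K : fieldType) (I : Type) (A : algType K) (h : I -> A)
    (X : lmodType K) (op : X -> X -> X) (f g : A -> X) :
  left_generated h -> linear f -> linear g -> f 1 = g 1 ->
  (forall x y, f (x * y) = op (f x) (f y)) ->
  (forall x y, g (x * y) = op (g x) (g y)) ->
  (forall i, f (h i) = g (h i)) -> f =1 g.
Proof.
move=> h_gen lf lg fg1 fM gM fg; apply: (generated_linear_eq h_gen lf lg fg1).
by move=> i x e; rewrite fM gM fg e.
Qed.

(** * Universal properties of the free algebra and of the presentation *)

Section FreeLift.
Variables (K : fieldType) (I : choiceType).

Definition word (k : fmonom I) : freealg K I := (<< k >> : {malg K[fmonom I]}).

Lemma word1 : word mone = 1. Proof. by []. Qed.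

Lemma wordM (k l : fmonom I) : word (mmul k l) = word k * word l.
Proof.
rewrite -[RHS]/(fmul (word k) (word l)) fmulE malgM_def.
by rewrite [RHS]fgmulUU mulr1.
Qed.

Lemma freegen_word i : freegen K i = word (fmu i).
Proof. exact: freegenE. Qed.

Lemma word_cons i s : word (FMonom (i :: s)) = freegen K i * word (FMonom s).
Proof.
rewrite freegen_word -wordM; congr word.
by apply/eqP; rewrite fmP fmM fmU.
Qed.

Lemma word_nil : word (FMonom [::]) = 1.
Proof. by rewrite -word1; congr word; apply/eqP; rewrite fmP fm1. Qed.

Lemma word_span (P : freealg K I -> Prop) :
  (forall x y, P x -> P y -> P (x + y)) -> (forall c x, P x -> P (c *: x)) ->
  (forall k, P (word k)) -> forall x, P x.
Proof.
move=> PD PZ Pw x.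
have P0 : P 0 by rewrite -(scale0r (word mone)); exact: PZ.
rewrite (_ : x = \sum_(k <- msupp (x : {malg K[fmonom I]}))
  (x : {malg K[fmonom I]})@_k *: word k); last first.
  rewrite [LHS](monalgE (x : {malg K[fmonom I]})); apply: eq_bigr => k _.
  by apply/malgP => l; rewrite mcoeffZ !mcoeffU mulrnAr mulr1.
by elim/big_ind: _ => // k _; exact: PZ.
Qed.

(** Peeling off the first letter of a word turns the spanning property into an
    induction over left multiplications by generators. *)
Lemma freegen_left_generated : left_generated (@freegen K I).
Proof.
move=> P PD PZ P1 Pg; apply: word_span => // -[].
by elim=> [|i s ih]; rewrite ?word_nil // word_cons; exact: Pg.
Qed.

Section Lift.
Variables (B : algType K) (h : I -> B).

Definition freelift (x : freealg K I) : B :=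
  malg_lift (fun k : fmonom I => \prod_(i <- (k : seq I)) h i) x.

Let freelift_linear : linear freelift.
Proof. exact: malg_lift_is_linear. Qed.

HB.instance Definition _ :=
  GRing.isLinear.Build K (freealg K I) B _ freelift freelift_linear.

Let freelift_word k : freelift (word k) = \prod_(i <- (k : seq I)) h i.
Proof. exact: malg_liftU. Qed.

Let freelift_monoid : monoid_morphism freelift.
Proof.
split=> [|x y]; first by rewrite -word1 freelift_word fm1 big_nil.
elim/word_span: x => [x1 x2 ih1 ih2|c x ih|k].
- by rewrite mulrDl !linearD /= ih1 ih2 mulrDl.
- by rewrite -scalerAl !linearZ_LR /= ih scalerAl.
elim/word_span: y => [y1 y2 ih1 ih2|c y ih|l].
- by rewrite mulrDr !linearD /= ih1 ih2 mulrDr.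
- by rewrite -scalerAr !linearZ_LR /= ih scalerAr.
by rewrite -wordM !freelift_word fmM big_cat.
Qed.

HB.instance Definition _ :=
  GRing.isMonoidMorphism.Build (freealg K I) B freelift freelift_monoid.

Lemma freeliftE i : freelift (freegen K i) = h i.
Proof. by rewrite freegen_word freelift_word fmU big_seq1. Qed.

End Lift.

Lemma freealg_morph_eq (B : algType K)
  (f g : {lrmorphism freealg K I -> B | *:%R}) :
  (forall i, f (freegen K i) = g (freegen K i)) -> f =1 g.
Proof.
apply: (generated_morph_eq (op := *%R) freegen_left_generated).
- by move=> c x y; exact: linearP.
- by move=> c x y; exact: linearP.
- by rewrite !rmorph1.
- by move=> x y; exact: rmorphM.
- by move=> x y; exact: rmorphM.
Qed.

End FreeLift.

Section UrsLift.
Variables (K : fieldType) (r s : K).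
Notation U := (Urs r s).

Lemma Ugen_left_generated : left_generated (@Ugen K r s : gen -> (U : algType K)).
Proof.
move=> P PD PZ P1 Pg x; have [y ->] := aqpi_surj x.
elim/freegen_left_generated: y => [y z hy hz|c y hy||g y hy].
- by rewrite linearD; exact: PD.
- by rewrite linearZ; exact: PZ.
- by [].
by rewrite rmorphM; exact: Pg.
Qed.

Definition respects (B : algType K) (h : gen -> B) :=
  forall x y, Urs_rel r s x y -> freelift h x = freelift h y.

Lemma Ugen_respects : respects (@Ugen K r s : gen -> (U : algType K)).
Proof.
move=> x y hxy; pose f : {lrmorphism freealg K gen -> (U : algType K) | *:%R} :=
  aqpi (Urs_rel r s).
have e : freelift (@Ugen K r s : gen -> (U : algType K)) =1 f.
  by apply: freealg_morph_eq => g; exact: freeliftE.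
rewrite !e; exact: aqpi_rel.
Qed.

Lemma Urs_lift (B : algType K) (h : gen -> B) : respects h ->
  {f : {lrmorphism (U : algType K) -> B | *:%R} | forall g, f (Ugen r s g) = h g}.
Proof.
move=> hR.
have hI x y : ideal_rel (Urs_rel r s) x y -> freelift h x = freelift h y.
  by case=> a x' y' b /hR e; rewrite !rmorphM /= e.
pose f (x : U) : B := freelift h (mqrepr x).
have fE x : f (aqpi (Urs_rel r s) x) = freelift h x by exact: span_rel_eq hI x.
have flin : linear f.
  move=> c x y; have [x' ->] := aqpi_surj x; have [y' ->] := aqpi_surj y.
  by rewrite -linearP !fE linearP.
have fmon : monoid_morphism f.
  split=> [|x y]; first by rewrite -[1]/(aqpi (Urs_rel r s) 1) fE rmorph1.
  have [x' ->] := aqpi_surj x; have [y' ->] := aqpi_surj y.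
  by rewrite -[_ * _]/(aqmul _ _) -aqpiM !fE rmorphM.
pose L1 := GRing.isLinear.Build K (U : algType K) B _ f flin.
pose L2 := GRing.isMonoidMorphism.Build (U : algType K) B f fmon.
pose L : {lrmorphism (U : algType K) -> B | *:%R} := HB.pack f L1 L2.
by exists L => g; rewrite -(freeliftE h g) -fE.
Qed.
End UrsLift.

(** * The scalars of the torus action *)

Lemma aform_refl i : aform i i = 1.
Proof. by rewrite /aform eqxx. Qed.

Lemma aform_succ i j : val j = (val i).+1 -> aform i j = -1 /\ aform j i = 0.
Proof. by rewrite /aform => ->; do !case: eqP; lia. Qed.

Lemma aform_far i j : (1 < `|(val i)%:Z - (val j)%:Z|)%R ->
  aform i j = 0 /\ aform j i = 0.
Proof. by rewrite /aform; do !case: eqP; lia. Qed.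

Section Weights.
Variables (K : fieldType) (r s : K).
Hypotheses (r0 : r != 0) (s0 : s != 0).

(** The scalar in w_i e_j = wt i j e_j w_i. The other three families of toral
    relations involve wt or its inverse, with i and j possibly exchanged. *)
Definition wt i j : K := r ^ aform j i * s ^ (- aform i j).

Lemma wt_neq0 i j : wt i j != 0.
Proof. by rewrite mulf_neq0 ?expfz_neq0. Qed.

Lemma wtV i j : (wt i j)^-1 = r ^ (- aform j i) * s ^ aform i j.
Proof. by rewrite /wt invfM !invr_expz opprK. Qed.

Lemma wt_refl i : wt i i = r / s.
Proof. by rewrite /wt aform_refl. Qed.

Lemma wt_succ i j : val j = (val i).+1 -> wt i j = s /\ wt j i = r^-1.
Proof.
by move=> /aform_succ[e1 e2]; rewrite /wt e1 e2 !expr0z opprK mul1r mulr1.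
Qed.

Lemma wt_far i j : (1 < `|(val i)%:Z - (val j)%:Z|)%R -> wt i j = 1 /\ wt j i = 1.
Proof. by move=> /aform_far[e1 e2]; rewrite /wt e1 e2 !expr0z mulr1. Qed.

(** * The relations in an arbitrary algebra *)

(** The defining relations for a family h in an algebra B, with scalars
    expressed by [wt] and Serre relations by [serre], the forms in which they
    are checked. *)
Record Urs_relations (B : algType K) (h : gen -> B) : Prop := {
  rel_toral g g' : is_toral g -> is_toral g' -> h g * h g' = h g' * h g;
  rel_wV i : h (GenW i) * h (GenWV i) = 1;
  rel_Vw i : h (GenWV i) * h (GenW i) = 1;
  rel_w'V i : h (GenW' i) * h (GenW'V i) = 1;
  rel_Vw' i : h (GenW'V i) * h (GenW' i) = 1;
  rel_we i j : qcomm (wt i j) (h (GenW i)) (h (GenE j));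
  rel_w'e i j : qcomm (wt j i)^-1 (h (GenW' i)) (h (GenE j));
  rel_wf i j : qcomm (wt i j)^-1 (h (GenW i)) (h (GenF j));
  rel_w'f i j : qcomm (wt j i) (h (GenW' i)) (h (GenF j));
  rel_ef i j : h (GenE i) * h (GenF j) - h (GenF j) * h (GenE i)
    = (i == j)%:R *: ((r - s)^-1 *: (h (GenW i) - h (GenW' i)));
  rel_ee i j : (1 < `|(val i)%:Z - (val j)%:Z|)%R ->
    qbr 1 (h (GenE i)) (h (GenE j)) = 0;
  rel_ff i j : (1 < `|(val i)%:Z - (val j)%:Z|)%R ->
    qbr 1 (h (GenF i)) (h (GenF j)) = 0;
  rel_serreE1 i j : val j = (val i).+1 ->
    serre r s (h (GenE i)) (h (GenE j)) = 0;
  rel_serreE2 i j : val j = (val i).+1 ->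
    serre s^-1 r^-1 (h (GenE j)) (h (GenE i)) = 0;
  rel_serreF1 i j : val j = (val i).+1 ->
    serre s^-1 r^-1 (h (GenF i)) (h (GenF j)) = 0;
  rel_serreF2 i j : val j = (val i).+1 ->
    serre r s (h (GenF j)) (h (GenF i)) = 0
}.

Section Respects.
Variables (B : algType K) (h : gen -> B).

Let rs0 : r * s != 0. Proof. exact: mulf_neq0. Qed.
Let rsV0 : r^-1 * s^-1 != 0. Proof. by rewrite mulf_neq0 ?invr_eq0. Qed.

Let flM x y : freelift h (x * y) = freelift h x * freelift h y.
Proof. exact: rmorphM. Qed.
Let flX x n : freelift h (x ^+ n) = freelift h x ^+ n.
Proof. exact: rmorphXn. Qed.
Let flD x y : freelift h (x + y) = freelift h x + freelift h y.
Proof. exact: raddfD. Qed.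
Let flN x : freelift h (- x) = - freelift h x.
Proof. exact: raddfN. Qed.
Let flZ c x : freelift h (c *: x) = c *: freelift h x.
Proof. exact: linearZ. Qed.
Let fl1 : freelift h 1 = 1. Proof. exact: rmorph1. Qed.
Let fl0 : freelift h 0 = 0. Proof. exact: raddf0. Qed.
Let flE := (flX, flN, flD, flZ, fl1, fl0, flM, freeliftE h).

Lemma Urs_relations_respects : Urs_relations h -> respects r s h.
Proof.
move=> H x y; case=> [g g' tg tg'|i|i|i|i|i j|i j|i j|i j|i j|i j far|i j far
  |i j adj|i j adj|i j adj|i j adj];
  rewrite !flE.
- exact: rel_toral.
- exact: rel_wV.
- exact: rel_Vw.
- exact: rel_w'V.
- exact: rel_Vw'.
- exact: rel_we.
- by rewrite [LHS](rel_w'e H) wtV.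
- by rewrite [LHS](rel_wf H) wtV.
- exact: rel_w'f.
- exact: rel_ef.
- by rewrite -(rel_ee H far) /qbr scale1r.
- by rewrite -(rel_ff H far) /qbr scale1r.
- by rewrite -(rel_serreE1 H adj) serreE.
- by rewrite serre_rev // (rel_serreE2 H adj) scaler0.
- by rewrite -(rel_serreF1 H adj) serreE [s^-1 + _]addrC [s^-1 * _]mulrC invfM.
- by rewrite invfM serre_rev ?invr_eq0 // !invrK serreC (rel_serreF2 H adj) scaler0.
Qed.

Lemma respects_Urs_relations : respects r s h -> Urs_relations h.
Proof.
move=> hR; split=> [g g' tg tg'|i|i|i|i|i j|i j|i j|i j|i j|i j far|i j far
  |i j adj|i j adj|i j adj|i j adj].
- by have := hR _ _ (RelTC r s tg tg'); rewrite !flE.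
- by have := hR _ _ (RelWV r s i); rewrite !flE.
- by have := hR _ _ (RelVW r s i); rewrite !flE.
- by have := hR _ _ (RelW'V r s i); rewrite !flE.
- by have := hR _ _ (RelVW' r s i); rewrite !flE.
- by have := hR _ _ (RelWE r s i j); rewrite !flE.
- by have := hR _ _ (RelW'E r s i j); rewrite !flE -wtV.
- by have := hR _ _ (RelWF r s i j); rewrite !flE -wtV.
- by have := hR _ _ (RelW'F r s i j); rewrite !flE.
- by have := hR _ _ (RelEF r s i j); rewrite !flE.
- by have := hR _ _ (RelEE r s far); rewrite !flE /qbr scale1r.
- by have := hR _ _ (RelFF r s far); rewrite !flE /qbr scale1r.
- by have := hR _ _ (RelSerreE1 r s adj); rewrite !flE serreE.
- have := hR _ _ (RelSerreE2 r s adj); rewrite !flE serre_rev // => /eqP.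
  by rewrite scaler_eq0 (negPf rs0) => /eqP.
- have := hR _ _ (RelSerreF1 r s adj).
  by rewrite !flE invfM -serreE serreC.
- have := hR _ _ (RelSerreF2 r s adj).
  rewrite !flE invfM serre_rev ?invr_eq0 // !invrK serreC => /eqP.
  by rewrite scaler_eq0 (negPf rsV0) => /eqP.
Qed.

End Respects.

Lemma counit_relations (B : algType K) :
  Urs_relations (fun g : gen => (is_toral g)%:R : B).
Proof.
have q10 c : qcomm c (1 : B) 0 by rewrite /qcomm mulr0 mul0r scaler0.
split=> [g g' -> ->|i|i|i|i|i j|i j|i j|i j|i j|i j _|i j _|i j _|i j _|i j _|i j _] //=;
  rewrite ?mulr1 ?qbr0l ?serre0 //.
by rewrite mulr0 !subrr !scaler0.
Qed.

(** * The images of the generators under the antipode *)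

Section Antipode.
Variables (B : algType K) (h : gen -> B) (H : Urs_relations h).

Definition antipode_gen (g : gen) : B^c :=
  match g with
  | GenE i => - (h (GenWV i) * h (GenE i))
  | GenF i => - (h (GenF i) * h (GenW'V i))
  | GenW i => h (GenWV i)
  | GenWV i => h (GenW i)
  | GenW' i => h (GenW'V i)
  | GenW'V i => h (GenW' i)
  end.

Let Ve i j : qcomm (wt i j) (h (GenE j)) (h (GenWV i)).
Proof. exact: qcomm_inv (rel_wV H i) (rel_Vw H i) (rel_we H i j). Qed.
Let V'e i j : qcomm (wt j i)^-1 (h (GenE j)) (h (GenW'V i)).
Proof. exact: qcomm_inv (rel_w'V H i) (rel_Vw' H i) (rel_w'e H i j). Qed.
Let Vf i j : qcomm (wt i j)^-1 (h (GenF j)) (h (GenWV i)).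
Proof. exact: qcomm_inv (rel_wV H i) (rel_Vw H i) (rel_wf H i j). Qed.
Let V'f i j : qcomm (wt j i) (h (GenF j)) (h (GenW'V i)).
Proof. exact: qcomm_inv (rel_w'V H i) (rel_Vw' H i) (rel_w'f H i j). Qed.
Let torC g g' : is_toral g -> is_toral g' -> qcomm 1 (h g) (h g').
Proof. by move=> tg tg'; rewrite /qcomm scale1r (rel_toral H). Qed.

Let antiE i :
  antipode_gen (GenE i) = (-1 : K) *: (h (GenWV i) * h (GenE i) : B) :> B^c.
Proof. by rewrite scaleN1r. Qed.

(* Moving w'_i^-1 to the left puts the images of the f_i into the same shape
   v x as those of the e_i, at the cost of a scalar independent of i. *)
Let antiF i :
  antipode_gen (GenF i) = - (r / s) *: (h (GenW'V i) * h (GenF i) : B) :> B^c.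
Proof. by rewrite /antipode_gen V'f wt_refl scaleNr. Qed.

Let qcomm_conv c (x y : B) : qcomm c x y -> qcomm c (y : B^c) x.
Proof. by []. Qed.

Let convN c (x y : B) : qcomm c x y -> qcomm c (y : B^c) (- x).
Proof. by move=> xy; apply: qcomm_conv; rewrite /qcomm mulNr mulrN scalerN xy. Qed.

Let serre_anti p q (x y v w : B) : p != 0 -> q != 0 -> v * w = w * v ->
  qcomm q y v -> qcomm p^-1 x w -> qcomm (p / q) x v -> serre p q x y = 0 ->
  serre p q (v * x : B^c) (w * y) = 0.
Proof. by move=> p0 q0 vw yv xw xv e; rewrite serre_twist // e mulr0. Qed.

Let qbr1_anti (x y v w : B) : v * w = w * v ->
  qcomm 1 y v -> qcomm 1 x w -> qbr 1 x y = 0 ->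
  qbr 1 (v * x : B^c) (w * y) = 0.
Proof.
move=> vw yv xw e; have n0 : (1 : K) * 1 != 0 by rewrite mulr1 oner_neq0.
by rewrite (qbr_twist n0 vw yv xw) mulr1 divr1 e mulr0 scaler0.
Qed.

(** Since f_j w_i^-1 and w'_j^-1 e_i reorder with mutually inverse scalars, the
    left-hand side is - w_i^-1 [e_i, f_j] w'_j^-1. *)
Let anti_ef i j :
  h (GenF j) * h (GenW'V j) * (h (GenWV i) * h (GenE i))
    - h (GenWV i) * h (GenE i) * (h (GenF j) * h (GenW'V j))
  = (i == j)%:R *: ((r - s)^-1 *: (h (GenWV i) - h (GenW'V i))).
Proof.
have V'e_sym : h (GenW'V j) * h (GenE i) = wt i j *: (h (GenE i) * h (GenW'V j)).
  by rewrite [LHS](qcomm_sym _ (V'e j i)) ?invr_eq0 ?wt_neq0 // invrK.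
have -> : h (GenF j) * h (GenW'V j) * (h (GenWV i) * h (GenE i))
    = h (GenWV i) * (h (GenF j) * h (GenE i)) * h (GenW'V j).
  rewrite mulrA -(mulrA (h (GenF j))) (@rel_toral _ _ H (GenW'V j) (GenWV i)) //.
  rewrite mulrA Vf -!mulrA V'e_sym -!(scalerAl, scalerAr) scalerA.
  by rewrite mulVf ?wt_neq0 // scale1r !mulrA.
have -> : h (GenWV i) * h (GenE i) * (h (GenF j) * h (GenW'V j))
    = h (GenWV i) * (h (GenE i) * h (GenF j)) * h (GenW'V j) by rewrite !mulrA.
rewrite -mulrBl -mulrBr -opprB (rel_ef H).
case: eqP => [<-|_]; last by rewrite !scale0r oppr0 mulr0 mul0r.
rewrite !scale1r mulrN mulNr -scalerAr -scalerAl -scalerN; congr (_ *: _).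
by rewrite mulrBr mulrBl (rel_Vw H) mul1r -mulrA (rel_w'V H) mulr1 opprB.
Qed.

Lemma antipode_relations : Urs_relations antipode_gen.
Proof.
split=> [g g' tg tg'|i|i|i|i|i j|i j|i j|i j|i j|i j far|i j far
  |i j adj|i j adj|i j adj|i j adj].
- by case: g g' tg tg' => ? // [] // ? _ _; apply: (rel_toral H).
- exact: (rel_wV H).
- exact: (rel_Vw H).
- exact: (rel_w'V H).
- exact: (rel_Vw' H).
- by apply: convN; rewrite -[wt i j]mul1r; apply: qcommMl; [exact: torC|exact: Ve].
- by apply: convN; rewrite -[_^-1]mul1r; apply: qcommMl; [exact: torC|exact: V'e].
- by apply: convN; rewrite -[_^-1]mulr1; apply: qcommMl; [exact: Vf|exact: torC].
- by apply: convN; rewrite -[wt j i]mulr1; apply: qcommMl; [exact: V'f|exact: torC].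
- by rewrite !mulrNN; exact: anti_ef.
- have [e1 e2] := wt_far far; rewrite !antiE qbrZl qbrZr.
  rewrite qbr1_anti ?scaler0 ?(rel_ee H) //; first exact: (rel_toral H).
  + by rewrite -e1; exact: Ve.
  + by rewrite -e2; exact: Ve.
- have [e1 e2] := wt_far far; rewrite !antiF qbrZl qbrZr.
  rewrite qbr1_anti ?scaler0 ?(rel_ff H) //; first exact: (rel_toral H).
  + by rewrite -e2; exact: V'f.
  + by rewrite -e1; exact: V'f.
- have [e1 e2] := wt_succ adj; rewrite !antiE serreZ serre_anti ?scaler0 //.
  + exact: (rel_toral H).
  + by rewrite -e1; exact: Ve.
  + by rewrite -e2; exact: Ve.
  + by rewrite -(wt_refl i); exact: Ve.
  + exact: (rel_serreE1 H).
- have [e1 e2] := wt_succ adj; rewrite !antiE serreZ serre_anti ?scaler0 ?invr_eq0 //.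
  + exact: (rel_toral H).
  + by rewrite -e2; exact: Ve.
  + by rewrite invrK -e1; exact: Ve.
  + by rewrite invrK mulrC -(wt_refl j); exact: Ve.
  + exact: (rel_serreE2 H).
- have [e1 e2] := wt_succ adj; rewrite !antiF serreZ serre_anti ?scaler0 ?invr_eq0 //.
  + exact: (rel_toral H).
  + by rewrite -e2; exact: V'f.
  + by rewrite invrK -e1; exact: V'f.
  + by rewrite invrK mulrC -(wt_refl i); exact: V'f.
  + exact: (rel_serreF1 H).
- have [e1 e2] := wt_succ adj; rewrite !antiF serreZ serre_anti ?scaler0 //.
  + exact: (rel_toral H).
  + by rewrite -e1; exact: V'f.
  + by rewrite -e2; exact: V'f.
  + by rewrite -(wt_refl j); exact: V'f.
  + exact: (rel_serreF2 H).
Qed.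
End Antipode.
End Weights.

(** * The images of the generators under the comultiplication *)

Section AugmentedTensor.
Variables (K : fieldType) (A : algType K) (eps : {lrmorphism A -> K | *%R}).

(** Algebras are nonzero rings by definition. An augmentation eps of A provides
    the functional eps ⊗ eps, which shows that 1 ⊗ 1 is nonzero; it is a phantom
    parameter of the type, so that A ⊗ A gets its algebra structure. *)
Definition augtens of {lrmorphism A -> K | *%R} : Type := A ⊗ A.
Local Notation T := (augtens eps).

HB.instance Definition _ := GRing.Lmodule.on T.
HB.instance Definition _ := GRing.PzRing.on T.

Definition ptens (a b : A) : T := a ⊗ b.

Lemma ptensM a b a' b' : ptens a b * ptens a' b' = ptens (a * a') (b * b').
Proof. exact: tmulE. Qed.

Lemma ptensP1 c a a' b : ptens (c *: a + a') b = c *: ptens a b + ptens a' b.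
Proof. exact: linearPl. Qed.

Lemma ptensP2 c a b b' : ptens a (c *: b + b') = c *: ptens a b + ptens a b'.
Proof. exact: linearPr. Qed.

Let augtens_nonzero : (1 : T) != 0.
Proof.
have bil : bilinear_for *:%R *:%R (fun a b : A => eps a * eps b : K^o).
  split=> [b|a] c x y /=; rewrite linearP; first by rewrite mulrDl -mulrA.
  by rewrite mulrDr mulrCA.
apply/eqP => e; have := tens_lift_is_linear bil (-1) (1 ⊗ 1) (1 ⊗ 1).
rewrite (tens_liftE bil) !scaleN1r !addNr -[0 : A ⊗ A]/(0 : T) -e.
by rewrite -[1 : T]/(1 ⊗ 1) (tens_liftE bil) !rmorph1 mulr1; apply/eqP/oner_neq0.
Qed.

HB.instance Definition _ := GRing.PzSemiRing_isNonZero.Build T augtens_nonzero.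

Let augtens_scaleAl (c : K) (x y : T) : c *: (x * y) = (c *: x) * y.
Proof. exact: tscaleAl. Qed.

HB.instance Definition _ := GRing.Lmodule_isLalgebra.Build K T augtens_scaleAl.

Let augtens_scaleAr (c : K) (x y : T) : c *: (x * y) = x * (c *: y).
Proof. exact: tscaleAr. Qed.

HB.instance Definition _ := GRing.Lalgebra_isAlgebra.Build K T augtens_scaleAr.

Lemma ptensDl a a' b : ptens (a + a') b = ptens a b + ptens a' b.
Proof. by rewrite -[a]scale1r ptensP1 !scale1r. Qed.

Lemma ptensDr a b b' : ptens a (b + b') = ptens a b + ptens a b'.
Proof. by rewrite -[b]scale1r ptensP2 !scale1r. Qed.

Lemma ptens0l b : ptens 0 b = 0.
Proof. by apply: (addrI (ptens 0 b)); rewrite -ptensDl !addr0. Qed.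

Lemma ptens0r a : ptens a 0 = 0.
Proof. by apply: (addrI (ptens a 0)); rewrite -ptensDr !addr0. Qed.

Lemma ptensZl c a b : ptens (c *: a) b = c *: ptens a b.
Proof. by rewrite -[c *: a]addr0 ptensP1 ptens0l addr0. Qed.

Lemma ptensZr c a b : ptens a (c *: b) = c *: ptens a b.
Proof. by rewrite -[c *: b]addr0 ptensP2 ptens0r addr0. Qed.

Lemma ptensBl a a' b : ptens (a - a') b = ptens a b - ptens a' b.
Proof. by rewrite ptensDl -scaleN1r ptensZl scaleN1r. Qed.

Lemma ptensBr a b b' : ptens a (b - b') = ptens a b - ptens a b'.
Proof. by rewrite ptensDr -scaleN1r ptensZr scaleN1r. Qed.

Lemma qbr_ptensl c g g' x y : g * g' = g' * g ->
  qbr c (ptens g x) (ptens g' y) = ptens (g * g') (qbr c x y).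
Proof. by move=> gg'; rewrite /qbr !ptensM -gg' ptensBr ptensZr. Qed.

Lemma qbr_ptensr c g g' x y : g * g' = g' * g ->
  qbr c (ptens x g) (ptens y g') = ptens (qbr c x y) (g * g').
Proof. by move=> gg'; rewrite /qbr !ptensM -gg' ptensBl ptensZl. Qed.

Lemma serre_ptensl p q g g' x y : g * g' = g' * g ->
  serre p q (ptens g x) (ptens g' y) = ptens (g * (g * g')) (serre p q x y).
Proof.
by move=> gg'; rewrite /serre qbr_ptensl // qbr_ptensl // -mulrA -gg'.
Qed.

Lemma serre_ptensr p q g g' x y : g * g' = g' * g ->
  serre p q (ptens x g) (ptens y g') = ptens (serre p q x y) (g * (g * g')).
Proof.
by move=> gg'; rewrite /serre qbr_ptensr // qbr_ptensr // -mulrA -gg'.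
Qed.

Lemma qcomm_ptensl c g x y : qcomm c g x -> qcomm c (ptens g y) (ptens x 1).
Proof. by rewrite /qcomm !ptensM mulr1 mul1r -ptensZl => ->. Qed.

Lemma qcomm_ptensr c g x y : qcomm c g x -> qcomm c (ptens y g) (ptens 1 x).
Proof. by rewrite /qcomm !ptensM mulr1 mul1r -ptensZr => ->. Qed.

Section Comultiplication.
Variables (r s : K) (h : gen -> A).
Hypotheses (r0 : r != 0) (s0 : s != 0) (H : Urs_relations r s h).

Definition comul_gen (g : gen) : T :=
  match g with
  | GenE i => ptens (h (GenE i)) 1 + ptens (h (GenW i)) (h (GenE i))
  | GenF i => ptens 1 (h (GenF i)) + ptens (h (GenF i)) (h (GenW' i))
  | _ => ptens (h g) (h g)
  end.

Local Opaque ptens.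

Let comul_toral g : is_toral g -> comul_gen g = ptens (h g) (h g).
Proof. by case: g. Qed.

Let toral_ptensr c t g x : qcomm c t x -> t * g = g * t ->
  qcomm c (ptens t t) (ptens g x).
Proof. by move=> tx tg; rewrite /qcomm !ptensM tx tg ptensZr. Qed.

Let toral_ptensl c t g x : qcomm c t x -> t * g = g * t ->
  qcomm c (ptens t t) (ptens x g).
Proof. by move=> tx tg; rewrite /qcomm !ptensM tx tg ptensZl. Qed.

Let e_skew i j : qcomm (wt r s i j)
  (ptens (h (GenW i)) (h (GenE i))) (ptens (h (GenE j)) 1).
Proof. exact: qcomm_ptensl (rel_we H i j). Qed.

Let f_skew i j : qcomm (wt r s j i)
  (ptens (h (GenF i)) (h (GenW' i))) (ptens 1 (h (GenF j))).
Proof. exact: qcomm_ptensr (rel_w'f H i j). Qed.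

(** The cross terms w_i f_j ⊗ e_i w'_j and f_j w_i ⊗ w'_j e_i agree, because
    the scalars in the two tensor factors are inverse to each other; the two
    remaining commutators telescope. *)
Let comul_ef i j : comul_gen (GenE i) * comul_gen (GenF j)
    - comul_gen (GenF j) * comul_gen (GenE i)
  = (i == j)%:R *: ((r - s)^-1 *: (comul_gen (GenW i) - comul_gen (GenW' i))).
Proof.
have skew : qcomm 1 (ptens (h (GenW i)) (h (GenE i)))
                    (ptens (h (GenF j)) (h (GenW' j))).
  have ew : qcomm (wt r s i j) (h (GenE i)) (h (GenW' j)).
    rewrite -[wt _ _ _ _]invrK; apply: qcomm_sym (rel_w'e H j i).
    by rewrite invr_eq0 wt_neq0.
  rewrite /qcomm !ptensM (rel_wf H) ew ptensZl ptensZr scalerA.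
  by rewrite mulVf ?wt_neq0.
have indep : qcomm 1 (ptens (h (GenE i)) 1) (ptens 1 (h (GenF j))).
  by rewrite /qcomm !ptensM !mul1r !mulr1 scale1r.
rewrite -qbr1E /= (addrC (ptens 1 _)) (qbrD_diag indep skew).
have -> : qbr 1 (ptens (h (GenE i)) 1) (ptens (h (GenF j)) (h (GenW' j)))
    = ptens (qbr 1 (h (GenE i)) (h (GenF j))) (h (GenW' j)).
  by rewrite qbr_ptensr mul1r ?mulr1.
have -> : qbr 1 (ptens (h (GenW i)) (h (GenE i))) (ptens 1 (h (GenF j)))
    = ptens (h (GenW i)) (qbr 1 (h (GenE i)) (h (GenF j))).
  by rewrite qbr_ptensl mulr1 ?mul1r.
rewrite qbr1E (rel_ef H); case: eqP => [<-|_]; last first.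
  by rewrite !scale0r ptens0l ptens0r addr0.
rewrite !scale1r ptensZl ptensZr -scalerDr; congr (_ *: _).
by rewrite ptensBl ptensBr addrC addrA subrK.
Qed.

Lemma comul_relations : Urs_relations r s comul_gen.
Proof.
split=> [g g' tg tg'|i|i|i|i|i j|i j|i j|i j|i j|i j far|i j far
  |i j adj|i j adj|i j adj|i j adj].
- by rewrite !comul_toral // !ptensM (rel_toral H tg tg').
- by rewrite !comul_toral // ptensM (rel_wV H).
- by rewrite !comul_toral // ptensM (rel_Vw H).
- by rewrite !comul_toral // ptensM (rel_w'V H).
- by rewrite !comul_toral // ptensM (rel_Vw' H).
- by apply: qcommD; [exact: qcomm_ptensl (rel_we H i j)
    | apply: toral_ptensr (rel_we H i j) _; exact: (rel_toral H)].
- by apply: qcommD; [exact: qcomm_ptensl (rel_w'e H i j)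
    | apply: toral_ptensr (rel_w'e H i j) _; exact: (rel_toral H)].
- by apply: qcommD; [exact: qcomm_ptensr (rel_wf H i j)
    | apply: toral_ptensl (rel_wf H i j) _; exact: (rel_toral H)].
- by apply: qcommD; [exact: qcomm_ptensr (rel_w'f H i j)
    | apply: toral_ptensl (rel_w'f H i j) _; exact: (rel_toral H)].
- exact: comul_ef.
- have [e1 e2] := wt_far r s far.
  rewrite /= qbrD_diag; last 2 first.
  + by rewrite -e2 -[wt _ _ _ _]invrK; apply: qcomm_sym;
      rewrite ?invr_eq0 ?wt_neq0 // e2 invr1 -e2; exact: e_skew.
  + by rewrite -e1; exact: e_skew.
  rewrite qbr_ptensr // qbr_ptensl; last exact: (rel_toral H).
  by rewrite (rel_ee H far) ptens0l ptens0r addr0.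
- have [e1 e2] := wt_far r s far.
  rewrite /= qbrD_diag; last 2 first.
  + by rewrite -e1 -[wt _ _ _ _]invrK; apply: qcomm_sym;
      rewrite ?invr_eq0 ?wt_neq0 // e1 invr1 -e1; exact: f_skew.
  + by rewrite -e2; exact: f_skew.
  rewrite qbr_ptensl // qbr_ptensr; last exact: (rel_toral H).
  by rewrite (rel_ff H far) ptens0l ptens0r addr0.
- have [e1 e2] := wt_succ r s adj; rewrite /= serreD //; last first.
    by split; [rewrite -e1 | rewrite -e2 | rewrite -(wt_refl r s i)]; exact: e_skew.
  rewrite serre_ptensr // serre_ptensl; last exact: (rel_toral H).
  by rewrite (rel_serreE1 H adj) ptens0l ptens0r addr0.
- have [e1 e2] := wt_succ r s adj; rewrite /= serreD ?invr_eq0 //; last first.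
    split; rewrite ?invrK; [rewrite -e2 | rewrite -e1 |
      rewrite mulrC -(wt_refl r s j)]; exact: e_skew.
  rewrite serre_ptensr // serre_ptensl; last exact: (rel_toral H).
  by rewrite (rel_serreE2 H adj) ptens0l ptens0r addr0.
- have [e1 e2] := wt_succ r s adj; rewrite /= serreD ?invr_eq0 //; last first.
    split; rewrite ?invrK; [rewrite -e2 | rewrite -e1 |
      rewrite mulrC -(wt_refl r s i)]; exact: f_skew.
  rewrite serre_ptensl // serre_ptensr; last exact: (rel_toral H).
  by rewrite (rel_serreF1 H adj) ptens0l ptens0r addr0.
- have [e1 e2] := wt_succ r s adj; rewrite /= serreD //; last first.
    by split; [rewrite -e1 | rewrite -e2 | rewrite -(wt_refl r s j)]; exact: f_skew.
  rewrite serre_ptensl // serre_ptensr; last exact: (rel_toral H).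
  by rewrite (rel_serreF2 H adj) ptens0l ptens0r addr0.
Qed.
End Comultiplication.
End AugmentedTensor.

(** * The Hopf axioms *)

Section HopfAxioms.
Local Opaque tpure tens_assoc tens_map tens_mul tens_evall tens_evalr tmul tens_op.

Variables (K : fieldType) (r s : K) (U : algType K) (h : gen -> U).
Local Notation E i := (h (GenE i)).
Local Notation F i := (h (GenF i)).
Local Notation W i := (h (GenW i)).
Local Notation V i := (h (GenWV i)).
Local Notation W' i := (h (GenW' i)).
Local Notation V' i := (h (GenW'V i)).

Hypothesis h_gen : left_generated h.

Variables (Delta : {lrmorphism U -> U ⊗ U | *:%R}).
Variables (eps : {lrmorphism U -> K | *%R}) (S : {linear U -> U}).
Hypothesis Santi : antimultiplicative S.

Hypothesis DeltaE : forall i, Delta (E i) = E i ⊗ 1 + W i ⊗ E i.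
Hypothesis DeltaF : forall i, Delta (F i) = 1 ⊗ F i + F i ⊗ W' i.
Hypothesis DeltaT : forall g, is_toral g ->
  Delta (h g) = h g ⊗ h g.
Hypothesis epsg : forall g, eps (h g) = (is_toral g)%:R.
Hypothesis SE : forall g, S (h g) = antipode_gen h g.
Hypothesis h_rel : Urs_relations r s h.

Let DeltaM x y : Delta (x * y) = Delta x * Delta y. Proof. exact: rmorphM. Qed.
Let DeltaD x y : Delta (x + y) = Delta x + Delta y. Proof. exact: raddfD. Qed.
Let DeltaZ c x : Delta (c *: x) = c *: Delta x. Proof. exact: linearZ. Qed.
Let Delta1 : Delta 1 = 1 ⊗ 1. Proof. exact: rmorph1. Qed.
Let epsM x y : eps (x * y) = eps x * eps y. Proof. exact: rmorphM. Qed.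
Let eps1 : eps 1 = 1. Proof. exact: rmorph1. Qed.

Let Delta_linear : linear Delta.
Proof. by move=> c x y; rewrite DeltaD DeltaZ. Qed.

Let idl : linear (fun x : U => x). Proof. by []. Qed.

Let mul_bilinear : bilinear_for *:%R *:%R (fun a b : U => a * b).
Proof.
by split=> [b|a] c y z /=; rewrite ?mulrDl ?mulrDr -?scalerAl -?scalerAr.
Qed.

Let evallE a b : tens_evall eps (a ⊗ b) = eps a *: b.
Proof. exact: tens_evallE. Qed.
Let evalrE a b : tens_evalr eps (a ⊗ b) = eps b *: a.
Proof. exact: tens_evalrE. Qed.

Lemma counitl_axiom x : tens_evall eps (Delta x) = x.
Proof.
have lF : linear (tens_evall eps) by exact: tens_evall_is_linear.
have FM : forall t u, tens_evall eps (t * u) = tens_evall eps t * tens_evall eps u.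
  apply: (tens_multiplicative lF lF lF mul_bilinear) => a b a' b'.
  by rewrite !evallE epsM -!(scalerAl, scalerAr) scalerA.
apply: (generated_linear_eq h_gen (linear_comp lF Delta_linear) idl) => [|a y e].
  by rewrite Delta1 evallE eps1 scale1r.
rewrite DeltaM FM e; congr (_ * y).
case: a => i; rewrite ?DeltaE ?DeltaF ?DeltaT // ?linD //.
all: by rewrite !evallE ?epsg ?eps1 /= ?scale1r ?scale0r ?add0r ?addr0.
Qed.

Lemma counitr_axiom x : tens_evalr eps (Delta x) = x.
Proof.
have lF : linear (tens_evalr eps) by exact: tens_evalr_is_linear.
have FM : forall t u, tens_evalr eps (t * u) = tens_evalr eps t * tens_evalr eps u.
  apply: (tens_multiplicative lF lF lF mul_bilinear) => a b a' b'.
  by rewrite !evalrE epsM -!(scalerAl, scalerAr) scalerA.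
apply: (generated_linear_eq h_gen (linear_comp lF Delta_linear) idl) => [|a y e].
  by rewrite Delta1 evalrE eps1 scale1r.
rewrite DeltaM FM e; congr (_ * y).
case: a => i; rewrite ?DeltaE ?DeltaF ?DeltaT // ?linD //.
all: by rewrite !evalrE ?epsg ?eps1 /= ?scale1r ?scale0r ?add0r ?addr0.
Qed.

Let tmul_bilinear : bilinear_for *:%R *:%R (@tmul K U U).
Proof. by split=> [b|a] c y z; [exact: tmulPl | exact: tmulPr]. Qed.

Let op3 : U ⊗ (U ⊗ U) -> U ⊗ (U ⊗ U) -> U ⊗ (U ⊗ U) :=
  @tens_op K U (tens U U) (fun a b : U => a * b) (@tmul K U U).

Let op3_bilinear : bilinear_for *:%R *:%R op3.
Proof. exact: tens_op_bilinear mul_bilinear tmul_bilinear. Qed.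

Let op3E (a : U) (t : U ⊗ U) (a' : U) (t' : U ⊗ U) :
  op3 (a ⊗ t) (a' ⊗ t') = (a * a' : U) ⊗ (t * t' : U ⊗ U).
Proof. exact: (tens_opE mul_bilinear tmul_bilinear). Qed.

Let mapDl (a b : U) : tens_map Delta idfun (a ⊗ b) = Delta a ⊗ b.
Proof. exact: tens_mapE. Qed.
Let mapDr (a b : U) : tens_map idfun Delta (a ⊗ b) = a ⊗ Delta b.
Proof. exact: tens_mapE. Qed.

(** Both composites U ⊗ U -> U ⊗ (U ⊗ U) are multiplicative for the product
    [op3], so that it suffices to compare them on the coproducts of the
    generators. *)
Lemma coassoc_axiom x :
  tens_assoc (tens_map Delta idfun (Delta x)) = tens_map idfun Delta (Delta x).
Proof.
have assoc_mul (t u : U ⊗ U) c d : tens_assoc ((t * u : U ⊗ U) ⊗ (c * d : U))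
    = op3 (tens_assoc (t ⊗ c)) (tens_assoc (u ⊗ d)).
  have la (z : U) : linear (fun t : U ⊗ U => tens_assoc (t ⊗ z)).
    apply: linear_comp; first exact: tens_assoc_is_linear.
    by move=> k v v'; rewrite linearPl.
  move: t u; apply: (tens_multiplicative (la _) (la c) (la d) op3_bilinear).
  move=> a b a' b'; cbv beta.
  apply: etrans (tens_assocE (a * a' : U) (b * b' : U) (c * d : U)) _.
  apply: etrans (esym (congr2 op3 (tens_assocE a b c) (tens_assocE a' b' d))).
  by rewrite op3E [(_ : U ⊗ U) * _]tmulE.
have lL : linear (fun t : U ⊗ U => tens_assoc (tens_map Delta idfun t)).
  by apply: linear_comp; [exact: tens_assoc_is_linear | exact: tens_map_is_linear].
have lM : linear (tens_map (@idfun U) Delta) by exact: tens_map_is_linear.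
have LM (t u : U ⊗ U) : tens_assoc (tens_map Delta idfun (t * u)) =
    op3 (tens_assoc (tens_map Delta idfun t)) (tens_assoc (tens_map Delta idfun u)).
  move: t u; apply: (tens_multiplicative lL lL lL op3_bilinear) => a b a' b'.
  by rewrite !(mapDl, mapDr) DeltaM; exact: assoc_mul.
have MM (t u : U ⊗ U) : tens_map idfun Delta (t * u) =
    op3 (tens_map (@idfun U) Delta t) (tens_map (@idfun U) Delta u).
  move: t u; apply: (tens_multiplicative lM lM lM op3_bilinear) => a b a' b'.
  by rewrite !(mapDl, mapDr) DeltaM; exact/esym/op3E.
apply: (generated_linear_eq h_gen (linear_comp lL Delta_linear) (linear_comp lM Delta_linear))
  => [|a y e].
  by rewrite Delta1 mapDl mapDr Delta1 tens_assocE.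
rewrite DeltaM LM MM e; congr (op3 _ _).
have LD (t u : U ⊗ U) : tens_assoc (tens_map Delta idfun (t + u)) =
    tens_assoc (tens_map Delta idfun t) + tens_assoc (tens_map Delta idfun u).
  by have := linD lL t u.
have LDl (x1 x2 : U ⊗ U) (z : U) : tens_assoc ((x1 + x2) ⊗ z) =
    tens_assoc (x1 ⊗ z) + tens_assoc (x2 ⊗ z).
  by rewrite linearDl; exact: linD (@tens_assoc_is_linear K U U U) _ _.
have tDr (z : U) (x1 x2 : U ⊗ U) : z ⊗ (x1 + x2) = z ⊗ x1 + z ⊗ x2.
  exact: linearDr.
have [ta|] := boolP (is_toral a).
  rewrite (DeltaT ta) mapDl mapDr (DeltaT ta).
  exact: tens_assocE.
case: a => // i _.
  rewrite DeltaE LD (linD lM) !(mapDl, mapDr) DeltaE Delta1 (DeltaT (g := GenW i)) //.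
  have l1 : tens_assoc ((E i ⊗ 1 + W i ⊗ E i) ⊗ (1 : U)) =
      E i ⊗ (1 ⊗ 1) + W i ⊗ (E i ⊗ 1).
    exact: etrans (LDl _ _ _) (congr2 +%R (tens_assocE _ _ _) (tens_assocE _ _ _)).
  apply: etrans (congr2 +%R l1 (tens_assocE (W i) (W i) (E i))) _.
  exact: etrans (esym (addrA _ _ _)) (congr1 (+%R _) (esym (tDr _ _ _))).
rewrite DeltaF LD (linD lM) !(mapDl, mapDr) DeltaF Delta1 (DeltaT (g := GenW' i)) //.
have l1 : tens_assoc ((1 ⊗ F i + F i ⊗ W' i) ⊗ W' i) =
    1 ⊗ (F i ⊗ W' i) + F i ⊗ (W' i ⊗ W' i).
  exact: etrans (LDl _ _ _) (congr2 +%R (tens_assocE _ _ _) (tens_assocE _ _ _)).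
apply: etrans (congr2 +%R (tens_assocE 1 1 (F i)) l1) _.
exact: etrans (addrA _ _ _) (congr1 (+%R^~ _) (esym (tDr _ _ _))).
Qed.

Let antil := fun t : U ⊗ U => tens_mul (tens_map S idfun t).
Let antir := fun t : U ⊗ U => tens_mul (tens_map idfun S t).

Let antil_linear : linear antil.
Proof. by apply: linear_comp; [exact: tens_mul_is_linear | exact: tens_map_is_linear]. Qed.
Let antir_linear : linear antir.
Proof. by apply: linear_comp; [exact: tens_mul_is_linear | exact: tens_map_is_linear]. Qed.
Let antilE a b : antil (a ⊗ b) = S a * b.
Proof. by rewrite /antil tens_mapE tens_mulE. Qed.
Let antirE a b : antir (a ⊗ b) = a * S b.
Proof. by rewrite /antir tens_mapE tens_mulE. Qed.

(** Since S (a a') b b' = S (a') (S (a) b) b', the value of S * id on t is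
    wedged between the factors of u; when it is a scalar, it can be pulled
    out. *)
Let antil_mul t u c : antil t = c *: 1 -> antil (t * u) = c *: antil u.
Proof.
move=> tc; move: u; apply: tens_linear_eq => [||a b].
- exact: linear_comp antil_linear (tens_mull_linear t).
- by move=> k x y; rewrite antil_linear scalerDr !scalerA mulrC.
rewrite antilE -[c *: _]mulr1 scalerAl.
suff sl : antil (t * (a ⊗ b)) = S a * antil t * b.
  by rewrite sl tc -!(scalerAl, scalerAr) !mulr1.
clear tc; move: t; apply: tens_linear_eq => [||a' b'].
- exact: linear_comp antil_linear (tens_mulr_linear (a ⊗ b)).
- by move=> k x y; rewrite antil_linear mulrDr mulrDl -scalerAr -scalerAl.
by rewrite [_ * _]tmulE !antilE Santi.2 !mulrA.
Qed.

(** Here it is the value on the second factor that gets wedged, as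
    a (a' S (b')) S (b). *)
Let antir_mul t u c : antir u = c *: 1 -> antir (t * u) = c *: antir t.
Proof.
move=> tc; move: t; apply: tens_linear_eq => [||a b].
- exact: linear_comp antir_linear (tens_mulr_linear u).
- by move=> k x y; rewrite antir_linear scalerDr !scalerA mulrC.
rewrite antirE.
suff sl : antir ((a ⊗ b) * u) = a * antir u * S b.
  by rewrite sl tc -!(scalerAl, scalerAr) !mulr1.
clear tc; move: u; apply: tens_linear_eq => [||a' b'].
- exact: linear_comp antir_linear (tens_mull_linear (a ⊗ b)).
- by move=> k x y; rewrite antir_linear mulrDr mulrDl -scalerAr -scalerAl.
by rewrite [_ * _]tmulE !antirE Santi.2 !mulrA.
Qed.

Let eps_linear1 : linear (fun x : U => eps x *: (1 : U)).
Proof. by move=> c x y; rewrite linearP scalerDl scalerA. Qed.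

Lemma antipodel_axiom x : tens_mul (tens_map S idfun (Delta x)) = eps x *: 1.
Proof.
apply: (generated_linear_eq h_gen (linear_comp antil_linear Delta_linear) eps_linear1)
  => [|a y e].
  by rewrite Delta1 antilE eps1 scale1r Santi.1 mulr1.
rewrite DeltaM epsM -scalerA -e -/(antil _); apply: antil_mul; rewrite epsg.
case: a => i.
- rewrite DeltaE (linD antil_linear) !antilE !SE /= mulr1 scale0r; exact: addNr.
- rewrite DeltaF (linD antil_linear) !antilE Santi.1 SE /= mul1r scale0r.
  by rewrite mulNr -mulrA (rel_Vw' h_rel) mulr1; exact: addrN.
- by rewrite DeltaT // antilE SE scale1r; exact: (rel_Vw h_rel).
- by rewrite DeltaT // antilE SE scale1r; exact: (rel_wV h_rel).
- by rewrite DeltaT // antilE SE scale1r; exact: (rel_Vw' h_rel).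
- by rewrite DeltaT // antilE SE scale1r; exact: (rel_w'V h_rel).
Qed.

Lemma antipoder_axiom x : tens_mul (tens_map idfun S (Delta x)) = eps x *: 1.
Proof.
apply: (generated_linear_eq h_gen (linear_comp antir_linear Delta_linear) eps_linear1)
  => [|a y e].
  by rewrite Delta1 antirE eps1 scale1r Santi.1 mulr1.
rewrite DeltaM epsM mulrC -scalerA -/(antir _) (antir_mul _ e); congr (_ *: _).
rewrite epsg.
case: a => i.
- rewrite DeltaE (linD antir_linear) !antirE Santi.1 SE /= mulr1 scale0r.
  by rewrite mulrN mulrA (rel_wV h_rel) mul1r; exact: addrN.
- rewrite DeltaF (linD antir_linear) !antirE !SE /= mul1r scale0r; exact: addNr.
- by rewrite DeltaT // antirE SE scale1r; exact: (rel_wV h_rel).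
- by rewrite DeltaT // antirE SE scale1r; exact: (rel_Vw h_rel).
- by rewrite DeltaT // antirE SE scale1r; exact: (rel_w'V h_rel).
- by rewrite DeltaT // antirE SE scale1r; exact: (rel_Vw' h_rel).
Qed.

Lemma hopf_axioms_of_generators : hopf_axioms Delta eps S.
Proof.
split=> x; [exact: coassoc_axiom | exact: counitl_axiom | exact: counitr_axiom
  | exact: antipodel_axiom | exact: antipoder_axiom].
Qed.

End HopfAxioms.

(** * Existence and uniqueness of the Hopf structure *)

Section HopfUrs.
Variables (K : fieldType) (r s : K).
Hypotheses (r0 : r != 0) (s0 : s != 0).
Notation U := (Urs r s : algType K).
Notation x_ := (@Ugen K r s : gen -> U).

Lemma Ugen_relations : Urs_relations r s x_.
Proof. exact: (respects_Urs_relations r0 s0 (@Ugen_respects K r s)). Qed.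

Lemma Urs_counit :
  {eps : {lrmorphism U -> K | *%R} | forall g, eps (x_ g) = (is_toral g)%:R}.
Proof.
have [f fg] := Urs_lift (Urs_relations_respects r0 s0 (counit_relations r s K^o)).
by exists f.
Qed.

Lemma Urs_comul : {Delta : {lrmorphism U -> U ⊗ U | *:%R} |
  [/\ forall g, is_toral g -> Delta (x_ g) = x_ g ⊗ x_ g,
      forall i, Delta (x_ (GenE i)) =
        x_ (GenE i) ⊗ 1 + x_ (GenW i) ⊗ x_ (GenE i)
    & forall i, Delta (x_ (GenF i)) =
        1 ⊗ x_ (GenF i) + x_ (GenF i) ⊗ x_ (GenW' i)]}.
Proof.
have [eps _] := Urs_counit.
have [f fg] := Urs_lift (Urs_relations_respects r0 s0
  (comul_relations eps r0 s0 Ugen_relations)).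
exists f; split=> [g tg|i|i]; rewrite fg //.
by case: g tg.
Qed.

Lemma Urs_antipode : {S : {linear U -> U} | antimultiplicative S /\
  forall g, S (x_ g) = antipode_gen x_ g}.
Proof.
have [f fg] := Urs_lift (Urs_relations_respects r0 s0
  (antipode_relations r0 s0 Ugen_relations)).
exists f; split=> //; split=> [|x y]; first exact: (rmorph1 f).
exact: (rmorphM f).
Qed.
Lemma Urs_hopf : exists (Delta : {lrmorphism U -> U ⊗ U | *:%R})
    (eps : {lrmorphism U -> K | *%R}) (S : {linear U -> U}),
  [/\ hopf_axioms Delta eps S, antimultiplicative S
    & [/\ forall g, is_toral g -> Delta (x_ g) = x_ g ⊗ x_ g,
         forall i, Delta (x_ (GenE i)) =
           x_ (GenE i) ⊗ 1 + x_ (GenW i) ⊗ x_ (GenE i),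
         forall i, Delta (x_ (GenF i)) =
           1 ⊗ x_ (GenF i) + x_ (GenF i) ⊗ x_ (GenW' i),
         forall g, eps (x_ g) = (is_toral g)%:R
       & forall g, S (x_ g) = antipode_gen x_ g]].
Proof.
have [Delta [DT DE DF]] := Urs_comul.
have [eps epsE] := Urs_counit.
have [S [Santi SE]] := Urs_antipode.
exists Delta, eps, S.
split; [| exact Santi | exact (And5 DT DE DF epsE SE)].
exact: (hopf_axioms_of_generators (@Ugen_left_generated K r s) Santi DE DF DT epsE SE
  Ugen_relations).
Qed.

End HopfUrs.

Lemma rvar_neq0 : rvar != 0.
Proof. by rewrite tofrac_eq0 polyC_eq0 polyX_eq0. Qed.

Lemma svar_neq0 : svar != 0.
Proof. by rewrite tofrac_eq0 polyX_eq0. Qed.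

Theorem proposition1p1 :
  exists (Delta : {lrmorphism Usl -> Usl ⊗ Usl | *:%R})
         (epsilon : {lrmorphism Usl -> Qrs | *%R})
         (S : {linear Usl -> Usl}),
  [/\ hopf_axioms Delta epsilon S,
      antimultiplicative S,
      [/\ comul_formulas Delta, counit_formulas epsilon & antipode_formulas S]
    & [/\ (forall Delta' : {lrmorphism Usl -> Usl ⊗ Usl | *:%R},
             comul_formulas Delta' -> Delta' =1 Delta),
          (forall epsilon' : {lrmorphism Usl -> Qrs | *%R},
             counit_formulas epsilon' -> epsilon' =1 epsilon)
        & (forall S' : {linear Usl -> Usl},
             antimultiplicative S' -> antipode_formulas S' -> S' =1 S)]].
Proof.
have [Delta [eps [S [hopf Santi [DT DE DF epsE SE]]]]] :=
  Urs_hopf rvar_neq0 svar_neq0.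
have comulD : comul_formulas Delta.
  by move=> i; split; [split; exact: DT | split; exact: DT | exact: DE | exact: DF].
have counitE : counit_formulas eps.
  by move=> i; split; [split; exact: epsE | split; exact: epsE | exact: epsE
    | exact: epsE].
have antiS : antipode_formulas S.
  by move=> i; split; [split; exact: SE | split; exact: SE | exact: SE | exact: SE].
have gens := @Ugen_left_generated Qrs rvar svar.
exists Delta, eps, S; split=> //; split.
- move=> Delta' D'; apply: (generated_morph_eq (op := @tmul Qrs Usl Usl) gens).
  + by move=> c x y; exact: linearP.
  + by move=> c x y; exact: linearP.
  + by rewrite !rmorph1.
  + by move=> x y; exact: rmorphM.
  + by move=> x y; exact: rmorphM.
  case=> i; have [[dw dV] [dw' dV'] de df] := D' i;
    have [[ew eV] [ew' eV'] ee ef] := comulD i.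
  + exact: etrans de (esym ee).
  + exact: etrans df (esym ef).
  + exact: etrans dw (esym ew).
  + exact: etrans dV (esym eV).
  + exact: etrans dw' (esym ew').
  + exact: etrans dV' (esym eV').
- move=> eps' D'; apply: (generated_morph_eq (X := Qrs^o) (op := *%R) gens).
  + by move=> c x y; exact: linearP.
  + by move=> c x y; exact: linearP.
  + by rewrite !rmorph1.
  + by move=> x y; exact: rmorphM.
  + by move=> x y; exact: rmorphM.
  case=> i; have [[dw dV] [dw' dV'] de df] := D' i;
    have [[ew eV] [ew' eV'] ee ef] := counitE i.
  + exact: etrans de (esym ee).
  + exact: etrans df (esym ef).
  + exact: etrans dw (esym ew).
  + exact: etrans dV (esym eV).
  + exact: etrans dw' (esym ew').
  + exact: etrans dV' (esym eV').
- move=> S' S'anti D'.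
  apply: (generated_morph_eq (op := fun x y : Usl => y * x) gens).
  + by move=> c x y; exact: linearP.
  + by move=> c x y; exact: linearP.
  + exact: etrans S'anti.1 (esym Santi.1).
  + exact: S'anti.2.
  + exact: Santi.2.
  case=> i; have [[dw dV] [dw' dV'] de df] := D' i;
    have [[ew eV] [ew' eV'] ee ef] := antiS i.
  + exact: etrans de (esym ee).
  + exact: etrans df (esym ef).
  + exact: etrans dw (esym ew).
  + exact: etrans dV (esym eV).
  + exact: etrans dw' (esym ew').
  + exact: etrans dV' (esym eV').
Qed.
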